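(* Let $2\le k\le n-1$, let $H:(-\varepsilon_0,\varepsilon_0)\to\mathrm{Herm}(n)$ be real-analytic with $H(0)\in\Sigma_k$, and let $\lambda_1(t)\le\dots\le\lambda_n(t)$ be the eigenvalues of $H(t)$, $\bar\lambda(t)=\frac1k\sum_{j=1}^k\lambda_j(t)$. Then there is $\varepsilon>0$ such that each of the functions $\mathfrak s_k(t)=D_k(H(t))$, $\mathfrak s_{i,j}(t)=\lambda_i(t)-\lambda_j(t)$ ($1\le i<j\le k$) and $\overline{\mathfrak s}_i(t)=\lambda_i(t)-\bar\lambda(t)$ ($1\le i\le k$) coincides on $[0,\varepsilon)$ with a convergent power series in $t$, and $$\mathrm{ord}_0(\mathfrak s_k)=\min_{1\le i<j\le k}\mathrm{ord}_0(\mathfrak s_{i,j})=\min_{1\le i\le k-1}\mathrm{ord}_0(\mathfrak s_{i,i+1})=\mathrm{ord}_0(\mathfrak s_{1,k})=\min_{1\le i\le k}\mathrm{ord}_0(\overline{\mathfrak s}_i).$$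
   Context: $\mathrm{Herm}(n)$: $n\times n$ complex Hermitian matrices; eigenvalues $\lambda_1(H)\le\dots\le\lambda_n(H)$. For $2\le k\le n-1$, $\Sigma_k=\{H:\lambda_1=\dots=\lambda_k<\lambda_{k+1}\}$. $D_k(H)=\sqrt{\frac1k\sum_{j=1}^k(\lambda_j(H)-\bar\lambda)^2}$ with $\bar\lambda=\frac1k\sum_{j=1}^k\lambda_j(H)$. For a function $g$ which on $[0,\varepsilon)$ coincides with a convergent power series $\sum_{m\ge0}a_mt^m$, $\mathrm{ord}_0(g)=\min\{m:a_m\ne0\}$, and $\mathrm{ord}_0(g)=\infty$ if all $a_m=0$. *)

(* Defs.v *)
From HB Require Import structures.
From mathcomp Require Import all_boot all_order all_algebra.
From mathcomp Require Import all_classical all_reals all_analysis.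
From mathcomp Require Import complex.
Set Implicit Arguments. Unset Strict Implicit. Unset Printing Implicit Defensive.
Import Order.TTheory GRing.Theory Num.Theory.
Import numFieldNormedType.Exports.
Local Open Scope classical_set_scope.
Local Open Scope ring_scope.

Section Defs.
Variable R : realType.

Definition herm_mx (n : nat) (H : 'M[R[i]]_n) : Prop :=
  (map_mx (@conjc R) H)^T = H.

Definition is_sorted_eigvals (n : nat) (H : 'M[R[i]]_n) (s : seq R) : Prop :=
  [/\ size s = n, sorted <=%R s &
      char_poly H = \prod_(x <- s) ('X - (x%:C)%C%:P)].

(* The sorted eigenvalue list (well defined for Hermitian H). *)
Definition eigvals (n : nat) (H : 'M[R[i]]_n) : seq R :=
  match pselect (exists s, is_sorted_eigvals H s) with
  | left P => projT1 (cid P)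
  | right _ => nseq n 0
  end.

(* lam H j = lambda_{j+1}(H)  (0-based index). *)
Definition lam (n : nat) (H : 'M[R[i]]_n) (j : nat) : R := nth 0 (eigvals H) j.

Definition lbar (n k : nat) (H : 'M[R[i]]_n) : R :=
  k%:R^-1 * \sum_(j < k) lam H j.

Definition Dk (n k : nat) (H : 'M[R[i]]_n) : R :=
  Num.sqrt (k%:R^-1 * \sum_(j < k) (lam H j - lbar k H) ^+ 2).

Definition in_Sigma (n k : nat) (H : 'M[R[i]]_n) : Prop :=
  (forall j, (j < k)%N -> lam H j = lam H 0) /\ lam H k.-1 < lam H k.

Definition ps_conv (a : nat -> R) (t0 t v : R) : Prop :=
  (fun N : nat => \sum_(m < N) a m * (t - t0) ^+ m) @ \oo --> v.

Definition real_analytic_on (eps0 : R) (f : R -> R) : Prop :=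
  forall t0, `|t0| < eps0 -> exists a : nat -> R, exists2 r : R, 0 < r &
    forall t, `|t - t0| < r -> `|t| < eps0 -> ps_conv a t0 t (f t).

Definition real_analytic_mx (n : nat) (eps0 : R) (H : R -> 'M[R[i]]_n) : Prop :=
  forall i j : 'I_n,
    real_analytic_on eps0 (fun t => @complex.Re R (H t i j)) /\
    real_analytic_on eps0 (fun t => @complex.Im R (H t i j)).

Definition ps_on (g : R -> R) (eps : R) (a : nat -> R) : Prop :=
  forall t, 0 <= t < eps -> ps_conv a 0 t (g t).

Definition has_ps_on (g : R -> R) (eps : R) : Prop := exists a, ps_on g eps a.

(* the coefficients of the expansion of g at 0^+ (unique when they exist) *)
Definition coefs0 (g : R -> R) : nat -> R :=
  match pselect (exists a, exists2 eps, 0 < eps & ps_on g eps a) with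
  | left P => projT1 (cid P)
  | right _ => fun _ => 0
  end.

Definition ordz (g : R -> R) : \bar R :=
  match pselect (exists m, coefs0 g m != 0) with
  | left P => ((ex_minn P)%:R)%:E
  | right _ => +oo%E
  end.

End Defs.

(* Main.v *)
Require Import Defs.
From HB Require Import structures.
From mathcomp Require Import all_boot all_order all_algebra.
From mathcomp Require Import all_classical all_reals all_analysis.
From mathcomp Require Import complex.
From mathcomp Require Import ring lra zify.
Import Order.TTheory GRing.Theory Num.Theory.
Import numFieldNormedType.Exports.
Local Open Scope classical_set_scope.
Local Open Scope ring_scope.
Set Implicit Arguments.
Unset Strict Implicit.
Unset Printing Implicit Defensive.

(** Only the characteristic polynomial matters: it is a monic family with analytic
    coefficients, real-rooted for small t of both signs.  Such a family splits into
    analytic linear factors (Rellich), by induction on the degree.  Translate the roots so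
    that they sum to 0; then the next coefficient is minus half the sum of the squared
    roots, so it has an even order 2m (its sign is the same on both sides of 0), hence all
    roots are O(t^m).  After rescaling by t^m the family at t = 0 has a real root but not
    all roots equal, so it factors by Hensel's lemma for convergent power series.  On
    t >= 0 the analytic roots can be ordered as germs, which gives the sorted eigenvalues;
    D_k is analytic by the same theorem applied to X^2 - D_k^2.  Finally ord_0 g >= m iff
    g = O(t^m), so the equalities of orders follow from pointwise inequalities. *)

(** * Germs of convergent power series *)

Section Germs.
Variable R : realType.
Implicit Types (a b : nat -> R) (f g : R -> R) (t : R).

(** The shape of the induction comes from the rescaling: dividing the roots by t^m makes sense only
    for t != 0, so splitting over the reals is assumed off 0 throughout. The value of the rescaled
    family at t = 0 is reached through its coefficients, by the identity principle, and compactness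
    supplies one real root x0 there. This suffices: the full power of X - x0 and its cofactor are
    coprime, and both Hensel factors inherit real-rootedness off 0. In Hensel's lemma the
    factorisation is solvable order by order by Bezout; the obstacle is convergence. The majorant
    argument needs only that the linearised equation has a bounded solution operator and that the
    remaining term is quadratic. *)

Definition psg a f := \forall t \near (0 : R), ps_conv a 0 t (f t).
Definition an f := exists a, psg a f.

Lemma near0_lt (r : R) : 0 < r -> \forall t \near (0 : R), `|t| < r.
Proof.
move=> r0; apply/nbhs_ballP; exists r => //= t.
by rewrite /ball /= sub0r normrN.
Qed.

Lemma near0_ex (P : R -> Prop) : (\forall t \near (0 : R), P t) ->
  exists2 r : R, 0 < r & forall t, `|t| < r -> P t.
Proof.
move=> /nbhs_ballP[r /= r0 h]; exists r => // t tr.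
by apply: h; rewrite /ball /= sub0r normrN.
Qed.

Lemma ps_conv_unique a t u v : ps_conv a 0 t u -> ps_conv a 0 t v -> u = v.
Proof. by apply: cvg_unique. Qed.

(** Each term is a difference of two consecutive partial sums, and these are bounded by some M
    because they converge; so each term is at most 2 M in absolute value. *)
Lemma ps_conv_geometric_bound a t v : t != 0 -> ps_conv a 0 t v ->
  exists K rho : R, [/\ 0 < K, 0 < rho & forall m, `|a m| <= K * rho ^+ m].
Proof.
move=> t0 cv.
have /cvg_seq_bounded : cvgn (fun N => \sum_(m < N) a m * (t - 0) ^+ m).
  by apply/cvg_ex; exists v.
rewrite /bounded_near => /pinfty_ex_gt0[M M0 hM].
exists (2 * M), (`|t|^-1); split.
- by rewrite mulr_gt0.
- by rewrite invr_gt0 normr_gt0.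
move=> m.
rewrite exprVn -ler_pdivrMr ?invr_gt0 ?exprn_gt0 ?normr_gt0// invrK -normrX -normrM.
have -> : a m * t ^+ m = (\sum_(i < m.+1) a i * (t - 0) ^+ i) -
                         (\sum_(i < m) a i * (t - 0) ^+ i).
  by rewrite big_ord_recr /= addrAC subrr add0r subr0.
have h1 := hM m.+1 I; have h2 := hM m I; rewrite /= in h1 h2.
by apply: (le_trans (ler_normB _ _)); rewrite mulr2n mulrDl mul1r lerD.
Qed.

Lemma psg_geometric_bound a f : psg a f ->
  exists K rho : R, [/\ 0 < K, 0 < rho & forall m, `|a m| <= K * rho ^+ m].
Proof.
move=> /near0_ex[r r0 h].
have /h : `|r / 2| < r by rewrite gtr0_norm ?divr_gt0 // ltr_pdivrMr // ltr_pMr // ltr1n.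
by apply: ps_conv_geometric_bound; rewrite gt_eqF // divr_gt0.
Qed.

Lemma sum_geometric_half N (x : R) : 0 <= x <= 2^-1 -> \sum_(m < N) x ^+ m <= 2.
Proof.
move=> /andP[x0 x2].
(* The subtracted term makes the induction go through, since 2 x^(N+1) <= x^N. *)
have h : \sum_(m < N) x ^+ m <= 2 - 2 * x ^+ N.
  elim: N => [|N ih]; first by rewrite big_ord0 expr0; lra.
  rewrite big_ord_recr /= exprS.
  have : 0 <= x ^+ N by rewrite exprn_ge0.
  by move=> xN; nra.
by apply: (le_trans h); rewrite gerBl mulr_ge0 // exprn_ge0.
Qed.

(** Comparison with a geometric series of ratio at most 1/2 gives absolute convergence. The bound K
    * 2 does not depend on t, so the sum stays bounded near 0. *)
Lemma geometric_bound_ps_conv a (K rho : R) t :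
  (forall m, `|a m| <= K * rho ^+ m) -> 0 <= rho -> `|t| * rho <= 2^-1 ->
  exists v, ps_conv a 0 t v /\ `|v| <= K * 2.
Proof.
move=> aK rho0 t2.
have K0 : 0 <= K by have := aK 0%N; rewrite expr0 mulr1; apply: le_trans.
pose u m := a m * (t - 0) ^+ m.
have uK m : `|u m| <= K * (`|t| * rho) ^+ m.
  rewrite /u subr0 normrM normrX exprMn (mulrC (`|t| ^+ m)) mulrA.
  by rewrite ler_wpM2r ?exprn_ge0.
have ser N : \sum_(m < N) a m * (t - 0) ^+ m = series u N.
  by rewrite /series /= big_mkord.
have bd N : \sum_(m < N) `|u m| <= K * 2.
  apply: (@le_trans _ _ (\sum_(m < N) K * (`|t| * rho) ^+ m)); first exact: ler_sum.
  by rewrite -mulr_sumr ler_wpM2l // sum_geometric_half // t2 mulr_ge0.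
have cvu : cvgn (series u).
  apply: normed_cvg; apply: nondecreasing_is_cvgn.
    by apply/nondecreasing_seqP => N; rewrite /= seriesSr lerDl.
  by exists (K * 2) => _ [N _ <-]; rewrite /= /series /= big_mkord; exact: bd.
exists (limn (series u)); split.
  rewrite /ps_conv; have -> : (fun N => \sum_(m < N) a m * (t - 0) ^+ m) = series u.
    by apply/funext => N; rewrite ser.
  exact: cvu.
rewrite -lim_norm //; apply: limr_le; first exact: is_cvg_norm.
apply: nearW => N; rewrite -ser.
by apply: le_trans (ler_norm_sum _ _ _) (bd N).
Qed.

Lemma near0_mul_le (rho c : R) : 0 < c -> \forall t \near (0 : R), `|t| * rho <= c.
Proof.
move=> c0; have r1 : 0 < `|rho| + 1 by rewrite ltr_wpDl.
near=> t; have : `|t| < c / (`|rho| + 1).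
  by near: t; apply: near0_lt; rewrite divr_gt0.
rewrite ltr_pdivlMr // => h; apply: le_trans (ltW h).
by rewrite ler_wpM2l // (le_trans (ler_norm _)) // lerDl.
Unshelve. all: by end_near. Qed.

Lemma geometric_bound_psg a (K rho : R) :
  (forall m, `|a m| <= K * rho ^+ m) -> 0 <= rho ->
  exists f, psg a f /\ \forall t \near (0 : R), `|f t| <= K * 2.
Proof.
move=> aK rho0.
have /choice[f hf] t : exists v, `|t| * rho <= 2^-1 -> ps_conv a 0 t v /\ `|v| <= K * 2.
  have [h|h] := boolP (`|t| * rho <= 2^-1); last by exists 0.
  by have [v hv] := geometric_bound_ps_conv aK rho0 h; exists v.
have nr : \forall t \near (0 : R), `|t| * rho <= 2^-1 by exact: near0_mul_le.
by exists f; split; near=> t; apply: (hf t _).1 || apply: (hf t _).2; near: t.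
Unshelve. all: by end_near. Qed.

Lemma psg_near a f g : (\forall t \near (0 : R), f t = g t) -> psg a f -> psg a g.
Proof. by move=> fg af; near=> t; rewrite -(near fg t) //; near: t.
Unshelve. all: by end_near. Qed.

Lemma psg_unique_near a f g : psg a f -> psg a g -> \forall t \near (0 : R), f t = g t.
Proof.
move=> af ag; near=> t; apply: (@ps_conv_unique a t); near: t; [exact: af|exact: ag].
Unshelve. all: by end_near. Qed.

Lemma psgD a b f g : psg a f -> psg b g -> psg (fun m => a m + b m) (fun t => f t + g t).
Proof.
move=> af bg; near=> t.
rewrite /ps_conv; under eq_fun do (under eq_bigr do rewrite mulrDl; rewrite big_split /=).
by apply: cvgD; near: t.
Unshelve. all: by end_near. Qed.

Lemma psgZ a f (c : R) : psg a f -> psg (fun m => c * a m) (fun t => c * f t).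
Proof.
move=> af; near=> t.
rewrite /ps_conv; under eq_fun do (under eq_bigr do rewrite -mulrA; rewrite -mulr_sumr).
by apply: cvgMr; near: t.
Unshelve. all: by end_near. Qed.

Lemma psgB a b f g : psg a f -> psg b g -> psg (fun m => a m - b m) (fun t => f t - g t).
Proof.
move=> af bg; have := psgD af (psgZ (-1) bg).
congr psg; apply/funext => x; by rewrite mulN1r.
Qed.

Lemma eq_psg a b f g : (forall m, a m = b m) -> (forall t, f t = g t) ->
  psg a f -> psg b g.
Proof. by move=> /funext-> /funext->. Qed.

Lemma psg0 : psg (fun=> 0) (fun=> 0).
Proof.
near=> t; rewrite /ps_conv.
have -> : (fun N => \sum_(m < N) (0 : R) * (t - 0) ^+ m) = fun=> 0.
  by apply/funext => N; rewrite big1 // => *; rewrite mul0r.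
exact: cvg_cst.
Unshelve. all: by end_near. Qed.

Lemma psg_sum n (a : nat -> nat -> R) (f : nat -> R -> R) :
  (forall i, (i < n)%N -> psg (a i) (f i)) ->
  psg (fun m => \sum_(i < n) a i m) (fun t => \sum_(i < n) f i t).
Proof.
elim: n => [|n ih] h.
  apply: (@eq_psg (fun=> 0) _ (fun=> 0)) => [m|t|]; rewrite ?big_ord0 //.
  exact: psg0.
apply: (eq_psg _ _ (psgD (ih (fun i hi => h i (ltnW hi))) (h n (leqnn _)))) => [m|t].
  by rewrite big_ord_recr.
by rewrite big_ord_recr.
Qed.

(** Both sides run over the triangle j + i < N, on the left by diagonals and on the right by
    rows. *)
Lemma sum_conv_triangle N (x y : nat -> R) :
  \sum_(l < N) \sum_(j < l.+1) x j * y (l - j)%N =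
  \sum_(j < N) x j * \sum_(i < N - j) y i.
Proof.
elim: N => [|N ih]; first by rewrite !big_ord0.
rewrite big_ord_recr /= ih [in RHS]big_ord_recr /= big_ord_recr /= addrA.
rewrite subSn // subnn big_ord1; congr (_ + _).
rewrite -big_split /=; apply: eq_bigr => j _.
by rewrite subSn ?(ltnW (ltn_ord j)) // big_ord_recr /= mulrDr.
Qed.

Lemma sum_conv_le N (x y : nat -> R) : (forall i, 0 <= x i) -> (forall i, 0 <= y i) ->
  \sum_(l < N) \sum_(j < l.+1) x j * y (l - j)%N <= (\sum_(j < N) x j) * (\sum_(i < N) y i).
Proof.
move=> x0 y0; rewrite sum_conv_triangle mulr_suml ler_sum // => j _.
rewrite ler_wpM2l //.
have mono p q : \sum_(i < p) y i <= \sum_(i < p + q) y i.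
  by rewrite big_split_ord /= lerDl sumr_ge0.
by have := mono (N - j)%N j; rewrite subnK // ltnW.
Qed.

(** The difference collects the pairs of indices below N whose sum is at least N: at most N^2
    products, each bounded by K^2 z^N because z <= 1, and N^2 <= 4^N. *)
Lemma sum_conv_err N (x y : nat -> R) (K z : R) :
  (forall i, `|x i| <= K * z ^+ i) -> (forall i, `|y i| <= K * z ^+ i) ->
  0 <= z <= 1 ->
  `|(\sum_(j < N) x j) * (\sum_(i < N) y i) -
    \sum_(l < N) \sum_(j < l.+1) x j * y (l - j)%N| <= K ^+ 2 * (4 * z) ^+ N.
Proof.
move=> xK yK /andP[z0 z1].
have K0 : 0 <= K by have := xK 0%N; rewrite expr0 mulr1; apply: le_trans.
have tail p q : `|\sum_(i < p + q) y i - \sum_(i < p) y i| <= q%:R * (K * z ^+ p).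
  rewrite big_split_ord /= addrAC subrr add0r.
  apply: (le_trans (ler_norm_sum _ _ _)).
  apply: (@le_trans _ _ (\sum_(i < q) K * z ^+ p)); last first.
    by rewrite sumr_const card_ord mulr_natl.
  apply: ler_sum => i _; apply: (le_trans (yK _)).
  by rewrite ler_wpM2l // ler_wiXn2l // leq_addr.
rewrite sum_conv_triangle mulr_suml -sumrB.
apply: (le_trans (ler_norm_sum _ _ _)).
apply: (@le_trans _ _ (\sum_(j < N) N%:R * (K ^+ 2 * z ^+ N))).
  apply: ler_sum => j _; rewrite -mulrBr normrM.
  have jN := ltnW (ltn_ord j).
  have := tail (N - j)%N j; rewrite subnK // => h.
  apply: (le_trans (ler_pM _ _ (xK j) h)) => //.
  have -> : z ^+ N = z ^+ j * z ^+ (N - j) by rewrite -exprD subnKC.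
  rewrite [leRHS](_ : _ = K * z ^+ j * (N%:R * (K * z ^+ (N - j)))); last by ring.
  by rewrite ler_wpM2l ?mulr_ge0 ?exprn_ge0 // ler_wpM2r ?mulr_ge0 ?exprn_ge0 // ler_nat.
rewrite sumr_const card_ord -mulr_natl exprMn.
rewrite [leLHS](_ : _ = K ^+ 2 * (N%:R ^+ 2 * z ^+ N)); last by ring.
rewrite ler_wpM2l ?sqr_ge0 // ler_wpM2r ?exprn_ge0 //.
rewrite (_ : 4 = 2 ^+ 2 :> R); last by rewrite -natrX.
by rewrite exprAC lerXn2r ?nnegrE // -natrX ler_nat ltnW // ltn_expl.
Qed.

Lemma cvg_dist_half (u v : nat -> R) (l C : R) : (forall N, `|u N - v N| <= C * 2^-1 ^+ N) ->
  u N @[N --> \oo] --> l -> v N @[N --> \oo] --> l.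
Proof.
move=> uv ul.
have g0 : geometric C (2^-1 : R) N @[N --> \oo] --> (0 : R).
  by apply: cvg_geometric; rewrite ger0_norm ?invr_ge0 // invf_lt1 // ltr1n.
apply: (@squeeze_cvgr _ _ _ _ (fun N => u N - geometric C (2^-1 : R) N) (fun N => u N + geometric C (2^-1 : R) N)).
- apply: nearW => N /=; have := uv N; rewrite ler_norml => /andP[h1 h2].
  by apply/andP; split; lra.
- by rewrite -[l]subr0; apply: cvgB.
- by rewrite -[l]addr0; apply: cvgD.
Qed.

Lemma psgM a b f g : psg a f -> psg b g ->
  psg (fun l => \sum_(j < l.+1) a j * b (l - j)%N) (fun t => f t * g t).
Proof.
move=> af bg.
have [Ka [ra [Ka0 ra0 aK]]] := psg_geometric_bound af.
have [Kb [rb [Kb0 rb0 bK]]] := psg_geometric_bound bg.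
pose K := Num.max Ka Kb; pose r := Num.max ra rb.
have r0 : 0 <= r by rewrite le_max (ltW ra0).
near=> t.
(* With z = |t| r this gives 4 z <= 1/2, so the Cauchy product differs from the product of the
   partial sums by at most K^2 / 2^N. *)
have tr : `|t| * r <= 8^-1 by near: t; apply: near0_mul_le.
have wk (c : nat -> R) (Kc rc : R) : 0 < Kc -> 0 < rc -> Kc <= K -> rc <= r ->
    (forall m, `|c m| <= Kc * rc ^+ m) ->
    forall m, `|c m * (t - 0) ^+ m| <= K * (`|t| * r) ^+ m.
  move=> Kc0 rc0 KcK rcr h m; rewrite subr0 normrM normrX exprMn (mulrC (`|t| ^+ m)) mulrA.
  rewrite ler_wpM2r ?exprn_ge0 // (le_trans (h m)) // ler_pM ?exprn_ge0 ?(ltW Kc0) ?(ltW rc0) //.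
  by rewrite lerXn2r ?nnegrE // ltW.
have leKm (x y : R) : x <= Num.max x y /\ y <= Num.max x y by rewrite !le_max !lexx orbT.
have ea := wk _ _ _ Ka0 ra0 (leKm _ _).1 (leKm _ _).1 aK.
have eb := wk _ _ _ Kb0 rb0 (leKm _ _).2 (leKm _ _).2 bK.
have z01 : 0 <= `|t| * r <= 1 by rewrite mulr_ge0 //= (le_trans tr) // invf_le1 // ler1n.
have cfg : (\sum_(m < N) a m * (t - 0) ^+ m) * (\sum_(m < N) b m * (t - 0) ^+ m)
    @[N --> \oo] --> f t * g t.
  by apply: cvgM; near: t.
apply: (cvg_dist_half (C := K ^+ 2) _ cfg) => N.
rewrite [X in `|_ - X|](_ : _ = \sum_(l < N) \sum_(j < l.+1)
   (a j * (t - 0) ^+ j) * (b (l - j)%N * (t - 0) ^+ (l - j))); last first.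
  apply: eq_bigr => l _; rewrite mulr_suml; apply: eq_bigr => j _.
  have jl : (j <= l)%N by rewrite -ltnS.
  have -> : (t - 0) ^+ l = (t - 0) ^+ j * (t - 0) ^+ (l - j) by rewrite -exprD subnKC.
  by ring.
apply: (le_trans (sum_conv_err N ea eb z01)).
rewrite ler_wpM2l ?sqr_ge0 // lerXn2r ?nnegrE ?mulr_ge0 ?invr_ge0 //.
by have := tr; lra.
Unshelve. all: by end_near. Qed.

Lemma psg_const (c : R) : psg (fun m => if m is 0%N then c else 0) (fun=> c).
Proof.
near=> t; rewrite /ps_conv -(cvg_shiftS _).
have -> : [sequence (\sum_(m < n.+1) (if nat_of_ord m is 0%N then c else 0) * (t - 0) ^+ m)]_n = fun=> c.
  apply/funext => N /=; rewrite big_ord_recl /= expr0 mulr1 big1 ?addr0 // => i _.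
  by rewrite mul0r.
exact: cvg_cst.
Unshelve. all: by end_near. Qed.

(** The quotient is summed from the shifted coefficients instead of dividing values, so it is also
    correct at t = 0. *)
Lemma psg_shift a f m : psg a f -> (forall i, (i < m)%N -> a i = 0) ->
  exists g, [/\ psg (fun i => a (m + i)%N) g,
    \forall t \near (0 : R), f t = t ^+ m * g t &
    exists C, \forall t \near (0 : R), `|g t| <= C].
Proof.
move=> af a0; have [K [r [K0 r0 aK]]] := psg_geometric_bound af.
have [g [ag gK]] : exists f, psg (fun i => a (m + i)%N) f /\ \forall t \near (0 : R), `|f t| <= K * r ^+ m * 2.
  apply: (@geometric_bound_psg _ _ r) (ltW r0) => i.
  by rewrite -mulrA -exprD.
exists g; split=> //; last by exists (K * r ^+ m * 2).
near=> t; apply: (@ps_conv_unique a t); first by near: t.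
rewrite /ps_conv -(cvg_shiftn m).
have -> : (fun n => \sum_(i < n + m) a i * (t - 0) ^+ i) =
   (fun n => t ^+ m * \sum_(i < n) a (m + i)%N * (t - 0) ^+ i).
  apply/funext => N; rewrite addnC big_split_ord /= big1 ?add0r; last first.
    by move=> i _; rewrite a0 ?mul0r.
  by rewrite mulr_sumr; apply: eq_bigr => i _; rewrite exprD subr0; ring.
by apply: cvgMr; near: t.
Unshelve. all: by end_near. Qed.

Lemma psg_at0 a f : psg a f -> f 0 = a 0%N.
Proof.
move=> /nbhs_singleton h; apply: (ps_conv_unique h).
rewrite /ps_conv -(cvg_shiftS _).
have -> : [sequence (\sum_(m < n.+1) a m * (0 - 0) ^+ m)]_n = fun=> a 0%N.
  apply/funext => N /=; rewrite big_ord_recl /= expr0 mulr1 big1 ?addr0 // => i _.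
  by rewrite subr0 expr0n mulr0.
exact: cvg_cst.
Qed.

Lemma an_cts f : an f -> exists C, \forall t \near (0 : R), `|f t - f 0| <= C * `|t|.
Proof.
move=> [a af].
have [|g [_ fg [C gC]]] := @psg_shift _ _ 1 (psgB af (psg_const (f 0))).
  by move=> [|//] _; rewrite (psg_at0 af) subrr.
exists C; near=> t; rewrite (near fg t) // normrM mulrC ler_wpM2r //.
by near: t.
Unshelve. all: by end_near. Qed.

Lemma an_cvg0 f (e : R) : an f -> 0 < e -> \forall t \near (0 : R), `|f t - f 0| < e.
Proof.
move=> /an_cts[C fC] e0; near=> t; apply: (@le_lt_trans _ _ (C * `|t|)); first by near: t.
apply: (@le_lt_trans _ _ (e / 2)); last by lra.
by rewrite mulrC; near: t; apply: near0_mul_le; lra.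
Unshelve. all: by end_near. Qed.

(** Cutting at the least nonzero coefficient writes a nonzero germ as a power of t times a germ not
    vanishing at 0. The arguments about signs, orders and divisibility of germs start from this
    form. *)
Lemma psg_lead a f : psg a f -> (forall m, a m = 0) \/
  exists m g, [/\ forall i, (i < m)%N -> a i = 0, a m != 0, an g, g 0 = a m &
    \forall t \near (0 : R), f t = t ^+ m * g t].
Proof.
move=> af; have [[m am]|h] := pselect (exists m, a m != 0); last first.
  left => m; apply/eqP; apply: contrapT => /negP am; apply: h; by exists m.
right; have [i ai imin] := ex_minnP (ex_intro (fun m => a m != 0) m am).
have ai0 j : (j < i)%N -> a j = 0.
  by move=> ji; apply/eqP; apply: contraLR ji => /imin; rewrite -leqNgt.
have [g [ag fg _]] := psg_shift af ai0.
exists i, g; split=> //; first by exists (fun j => a (i + j)%N).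
by rewrite (psg_at0 ag) addn0.
Qed.

Lemma an_lead f : an f -> (\forall t \near (0 : R), f t = 0) \/
  exists m g, [/\ an g, g 0 != 0 & \forall t \near (0 : R), f t = t ^+ m * g t].
Proof.
move=> [a af]; have [a0|[m [g [_ am ag ga fg]]]] := psg_lead af; last first.
  by right; exists m, g; split=> //; rewrite ga.
left; apply: psg_unique_near af _; apply: eq_psg psg0 => //.
Qed.

Lemma an_nonzero g : an g -> g 0 != 0 ->
  \forall t \near (0 : R), `|g t - g 0| < `|g 0| / 2.
Proof. by move=> ag g0; apply: an_cvg0 => //; rewrite divr_gt0 // normr_gt0. Qed.

Lemma an_nonzero_lb g : an g -> g 0 != 0 ->
  \forall t \near (0 : R), `|g 0| / 2 <= `|g t|.
Proof.
move=> ag g0; near=> t.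
have : `|g t - g 0| < `|g 0| / 2 by near: t; exact: an_nonzero.
by have := lerB_dist (g 0) (g t); rewrite distrC; lra.
Unshelve. all: by end_near. Qed.

(** Turns an eventual property into one positive witness that also works at -t; the pair serves to
    compare the two sides of 0. *)
Lemma near0_pos (P : R -> Prop) : (\forall t \near (0 : R), P t) ->
  exists2 t, 0 < t & P t /\ P (- t).
Proof.
move=> /near0_ex[r r0 h]; exists (r / 2); first by rewrite divr_gt0.
have r2 : `|r / 2| < r by rewrite gtr0_norm ?divr_gt0 // ltr_pdivrMr // ltr_pMr // ltr1n.
by split; apply: h => //; rewrite normrN.
Qed.

(** Real germs, complex-valued germs, families of polynomials and one-sided germs all share these
    closure properties, so sums, products and powers are treated once for an arbitrary class
    [good]. *)
Definition closed_fun (T : Type) (A : pzRingType) (good : (T -> A) -> Prop) :=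
  [/\ forall c, good (fun=> c),
      forall f g : T -> A, good f -> good g -> good (fun t : T => f t + g t) &
      forall f g : T -> A, good f -> good g -> good (fun t : T => f t * g t)].

Lemma an_closed : closed_fun an.
Proof.
split=> [c|f g [a af] [b bg]|f g [a af] [b bg]]; first by eexists; exact: psg_const.
- by eexists; apply: psgD; eassumption.
- by eexists; apply: psgM; eassumption.
Qed.

Lemma an_id : an id.
Proof.
exists (fun m => (m == 1%N)%:R); near=> t; rewrite /ps_conv -(cvg_shiftn 2).
have -> : (fun n => \sum_(m < n + 2) (nat_of_ord m == 1%N)%:R * (t - 0) ^+ m) = fun=> t.
  apply/funext => N /=; rewrite addn2 !big_ord_recl /= mul0r mul1r subr0 add0r expr1.
  by rewrite big1 ?addr0 // => i _; rewrite mul0r.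
exact: cvg_cst.
Unshelve. all: by end_near. Qed.

End Germs.

(** * Classes of functions closed under constants, sums and products *)

Section ClosedFun.
Variables (T : Type) (A : nzRingType) (good : (T -> A) -> Prop).
Hypothesis cl : closed_fun good.

Lemma closed_fun_sum (I : Type) (s : seq I) (P : pred I) (F : I -> T -> A) :
  (forall i, P i -> good (F i)) -> good (fun t => \sum_(i <- s | P i) F i t).
Proof.
case: cl => cst add _ h; elim: s => [|i s ih].
  by under eq_fun do rewrite big_nil; exact: cst.
under eq_fun do rewrite big_cons.
by case: (boolP (P i)) => // Pi; apply: add => //; exact: h.
Qed.

Lemma closed_fun_prod (I : Type) (s : seq I) (P : pred I) (F : I -> T -> A) :
  (forall i, P i -> good (F i)) -> good (fun t => \prod_(i <- s | P i) F i t).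
Proof.
case: cl => cst _ mul h; elim: s => [|i s ih].
  by under eq_fun do rewrite big_nil; exact: cst.
under eq_fun do rewrite big_cons.
by case: (boolP (P i)) => // Pi; apply: mul => //; exact: h.
Qed.

Lemma closed_funX (f : T -> A) n : good f -> good (fun t => f t ^+ n).
Proof.
case: cl => cst _ mul fg; elim: n => [|n ih].
  by under eq_fun do rewrite expr0; exact: cst.
by under eq_fun do rewrite exprS; apply: mul.
Qed.

Lemma closed_funN (f : T -> A) : good f -> good (fun t => - f t).
Proof.
case: cl => cst _ mul fg.
by under eq_fun do rewrite -mulN1r; apply: mul => //; exact: cst.
Qed.

Lemma closed_funB (f g : T -> A) : good f -> good g -> good (fun t => f t - g t).
Proof. by case: cl => _ add _ fg /closed_funN; exact: add. Qed.

Definition goodp (p : T -> {poly A}) := forall i, good (fun t => (p t)`_i).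
End ClosedFun.

Lemma goodp_closed (T : Type) (A : nzRingType) (good : (T -> A) -> Prop) :
  closed_fun good -> closed_fun (goodp good).
Proof.
move=> cl; have [cst add mul] := cl; split=> [c i|p q pg qg i|p q pg qg i].
- exact: cst.
- by under eq_fun do rewrite coefD; exact: add.
- under eq_fun do rewrite coefM.
  by apply: closed_fun_sum => // j _; exact: mul.
Qed.

Lemma goodpC (T : Type) (A : nzRingType) (good : (T -> A) -> Prop) (f : T -> A) :
  closed_fun good -> good f -> goodp good (fun t => (f t)%:P).
Proof.
move=> [cst _ _] fg i; under eq_fun do rewrite coefC.
by case: (i == 0%N) => //; exact: cst.
Qed.

(** * Order, division and the identity principle for germs *)

Section Germs2.
Variable R : realType.
Implicit Types (f g : R -> R) (t : R).

(** If M < m, cancelling t^M leaves |g t| <= C t^(m - M), which tends to 0, against g 0 != 0. Only t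
    > 0 enters, so one-sided bounds are covered as well. *)
Lemma order_le_of_bound g m M (C : R) : an g -> g 0 != 0 ->
  (\forall t \near (0 : R), 0 < t -> `|t ^+ M * g t| <= C * t ^+ m) -> (m <= M)%N.
Proof.
move=> ag g0 gC; rewrite leqNgt; apply/negP => Mm.
have := an_nonzero_lb ag g0; rewrite -normr_gt0 in g0.
move=> gl.
(* For such t, C t^(m - M) <= (|C| + 1) t <= |g 0| / 3, which is below the lower bound |g 0| / 2. *)
have : \forall t \near (0 : R), [/\ 0 < t -> `|t ^+ M * g t| <= C * t ^+ m,
   `|g 0| / 2 <= `|g t|, `|t| * (`|C| + 1) <= `|g 0| / 3 & `|t| * 1 <= 1].
  by near=> t; split; near: t => //; apply: near0_mul_le; lra.
move=> /near0_pos[t t0 [[/(_ t0) h1 h2 h3 h4] _]].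
move: h1; rewrite normrM normrX (gtr0_norm t0) in h3 h4 *.
rewrite -(subnKC (ltnW Mm)) exprD mulrCA ler_pM2l ?exprn_gt0 //.
move=> h5.
have tt : t ^+ (m - M) <= t.
  rewrite -subn_gt0 in Mm; case: (m - M)%N Mm => // d _.
  by rewrite exprS ler_piMr ?(ltW t0) // exprn_ile1 ?(ltW t0) //; lra.
have : C * t ^+ (m - M) <= (`|C| + 1) * t.
  apply: (@le_trans _ _ (`|C| * t ^+ (m - M))).
    by rewrite ler_wpM2r ?exprn_ge0 ?ler_norm // ltW.
  by rewrite ler_pM ?exprn_ge0 ?ler_wpDr // ltW.
by lra.
Unshelve. all: by end_near. Qed.

(** The growth bound forces the order of f to be at least m. It is asked off 0 only, because it will
    come from roots that are controlled only there. *)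
Lemma an_div f m (C : R) : an f ->
  (\forall t \near (0 : R), t != 0 -> `|f t| <= C * `|t| ^+ m) ->
  exists2 g, an g & \forall t \near (0 : R), f t = t ^+ m * g t.
Proof.
move=> af fC; have [f0|[M [g [ag g0 fg]]]] := an_lead af.
  exists (fun=> 0); first by have [cst _ _] := an_closed R; exact: cst.
  by apply: filterS f0 => t ->; rewrite mulr0.
have mM : (m <= M)%N.
  apply: (@order_le_of_bound g m M C) => //; near=> t => t0.
  have -> : t ^+ m = `|t| ^+ m by rewrite gtr0_norm.
  have <- : f t = t ^+ M * g t by near: t.
  by move: (lt0r_neq0 t0); near: t.
exists (fun t => t ^+ (M - m) * g t).
  have [_ _ mul] := an_closed R; apply: mul => //.
  exact: (closed_funX (an_closed R) _ (@an_id R)).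
by apply: filterS fg => t ->; rewrite mulrA -exprD subnKC.
Unshelve. all: by end_near. Qed.

(** Identity principle: a germ t^M h with h 0 != 0 has no zero off 0 near 0. It carries identities
    known off 0 over to t = 0. *)
Lemma an_punct f g : an f -> an g ->
  (\forall t \near (0 : R), t != 0 -> f t = g t) -> \forall t \near (0 : R), f t = g t.
Proof.
move=> af ag fg; have [f0|[M [h [ah h0 fh]]]] := an_lead (closed_funB (an_closed R) af ag).
  by apply: filterS f0 => t /eqP; rewrite subr_eq0 => /eqP.
exfalso; have hl := an_nonzero_lb ah h0.
have : \forall t \near (0 : R), [/\ t != 0 -> f t = g t, f t - g t = t ^+ M * h t & `|h 0| / 2 <= `|h t|].
  by near=> t; split; near: t.
move=> /near0_pos[t t0 [[h1 h2 h3] _]].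
have tn := lt0r_neq0 t0.
move: h2; rewrite h1 // subrr => /esym/eqP; rewrite mulf_eq0 expf_eq0 (negbTE tn) andbF /=.
move=> /eqP ht; rewrite ht normr0 in h3; rewrite -normr_gt0 in h0; lra.
Unshelve. all: by end_near. Qed.
End Germs2.

(** * Hensel's lemma for convergent power series *)

(** Course-of-values recursion: [F] receives the list of all earlier values. *)
Lemma prefix_rec (T : Type) (F : seq T -> T) : exists g : nat -> T, forall m, g m = F (mkseq g m).
Proof.
pose L m := iter m (fun s => rcons s (F s)) [::].
exists (fun m => F (L m)) => m; congr F.
by elim: m => //= m ih; rewrite mkseqS -{}ih.
Qed.

Section Hensel.
Variable R : realType.

Lemma sum_mono (y : nat -> R) p q : (forall i, 0 <= y i) -> (p <= q)%N ->
  \sum_(i < p) y i <= \sum_(i < q) y i.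
Proof. by move=> y0 /subnKC <-; rewrite big_split_ord /= lerDl sumr_ge0. Qed.

(* The generating function B of b satisfies B <= C (phi + B^2), so at a small point x
   all its partial sums stay below 1/(2C). *)
Lemma quadratic_majorant (b : nat -> R) (C K r : R) : 0 < C -> 0 < K -> 0 < r ->
  b 0%N = 0 -> (forall m, 0 <= b m) ->
  (forall m, (0 < m)%N -> b m <= C * (K * r ^+ m + \sum_(j < m.+1) b j * b (m - j)%N)) ->
  exists K' r' : R, 0 <= r' /\ forall m, b m <= K' * r' ^+ m.
Proof.
move=> C0 K0 r0 b0 bge brec.
pose be := (2 * C)^-1.
have be0 : 0 < be by rewrite invr_gt0 mulr_gt0.
(* Here y stands for r x. The bound 1/2 keeps the geometric sum below 2; the other bound gives 2 C^2
   K y <= 1/4, which with (C be)^2 = 1/4 closes the induction at C be = 1/2. *)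
pose y := Num.min 2^-1 (8 * K * C ^+ 2)^-1.
have y0 : 0 < y.
  by rewrite lt_min !invr_gt0 ltr0n /= !mulr_gt0 // exprn_gt0.
have y2 : 0 <= y <= 2^-1 by rewrite (ltW y0) /= ge_min lexx.
have yK : 8 * K * C ^+ 2 * y <= 1.
  rewrite mulrC -ler_pdivlMr ?mul1r; last by rewrite !mulr_gt0 // exprn_gt0.
  by rewrite /y ge_min lexx orbT.
pose x := y / r; have x0 : 0 < x by rewrite divr_gt0.
have xr : r * x = y by rewrite /x mulrCA divff ?mulr1 // gt_eqF.
pose X m := b m * x ^+ m.
have Xge m : 0 <= X m by rewrite mulr_ge0 // exprn_ge0 // ltW.
have X0 : X 0%N = 0 by rewrite /X b0 mul0r.
have Xrec m : X m <= C * (K * ((0 < m)%:R * y ^+ m) + \sum_(j < m.+1) X j * X (m - j)%N).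
  case: m => [|m].
    by rewrite X0 !mul0r mulr0 add0r mulr_ge0 ?(ltW C0) // sumr_ge0 // => j _; rewrite mulr_ge0.
  rewrite mul1r -xr exprMn.
  have -> : \sum_(j < m.+2) X j * X (m.+1 - j)%N = (\sum_(j < m.+2) b j * b (m.+1 - j)%N) * x ^+ m.+1.
    rewrite mulr_suml; apply: eq_bigr => j _; rewrite /X.
    have -> : x ^+ m.+1 = x ^+ j * x ^+ (m.+1 - j) by rewrite -exprD subnKC // -ltnS.
    by ring.
  rewrite (mulrA K) -mulrDl mulrA /X ler_pM2r ?exprn_gt0 //.
  exact: brec.
have B N : \sum_(m < N) X m <= be.
  elim: N => [|N ih]; first by rewrite big_ord0 ltW.
  apply: (le_trans (ler_sum _ (fun (m : 'I_N.+1) _ => Xrec m))).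
  rewrite -mulr_sumr big_split /= -mulr_sumr sum_conv_triangle.
  have s1 : \sum_(i < N.+1) (0 < i)%:R * y ^+ i <= 2 * y.
    rewrite big_ord_recl /= mul0r add0r.
    rewrite (eq_bigr (fun i : 'I_N => y * y ^+ i)); last by move=> i _; rewrite mul1r -exprS.
    by rewrite -mulr_sumr mulrC ler_wpM2r ?(ltW y0) // sum_geometric_half.
  (* Since X 0 = 0, the terms j = 0 and j = N drop out and the other inner sums have at most N
     terms; so the induction hypothesis, at N, bounds both factors. *)
  have s2 : \sum_(j < N.+1) X j * \sum_(i < N.+1 - j) X i <= be ^+ 2.
    rewrite big_ord_recr /= subSnn big_ord1 X0 mulr0 addr0.
    have S0 : 0 <= \sum_(j < N) X j by exact: sumr_ge0.
    apply: (@le_trans _ _ ((\sum_(j < N) X j) ^+ 2)); last by rewrite lerXn2r ?nnegrE // ltW.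
    rewrite expr2 mulr_suml; apply: ler_sum => j _.
    have [->|j0] := posnP j; first by rewrite X0 !mul0r.
    by rewrite ler_wpM2l // sum_mono // leq_subLR -add1n leq_add2r.
  apply: (@le_trans _ _ (C * (K * (2 * y) + be ^+ 2))).
    by rewrite ler_wpM2l ?(ltW C0) // lerD // ler_wpM2l // ltW.
  have e1 : C * be = 2^-1 by rewrite /be invfM mulrCA divff ?mulr1 // gt_eqF.
  rewrite -(ler_pM2l C0) e1.
  have -> : C * (C * (K * (2 * y) + be ^+ 2)) = (8 * K * C ^+ 2 * y) / 4 + (C * be) ^+ 2 by field.
  by rewrite e1; lra.
exists be, x^-1; split=> [|m]; first by rewrite invr_ge0 ltW.
rewrite exprVn ler_pdivlMr ?exprn_gt0 //; apply: le_trans (B m.+1).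
by rewrite big_ord_recr /= lerDr sumr_ge0.
Qed.

(** The linearised equation of the factorisation problem. Reduction modulo g bounds the degree of u;
    the bound for v follows by comparing degrees in g v = w - h u. *)
Lemma bezout_bounded (g h w : {poly R}) (p q : nat) : g \is monic -> h \is monic ->
  size g = p.+1 -> size h = q.+1 -> coprimep g h -> (size w <= p + q)%N ->
  exists uv : {poly R} * {poly R},
    [/\ (size uv.1 <= p)%N, (size uv.2 <= q)%N & g * uv.2 + h * uv.1 = w].
Proof.
move=> gm hm gp hq /Bezout_eq1_coprimepP[[a b] /= ab] wpq.
pose u := (b * w) %% g; pose v := a * w + h * ((b * w) %/ g).
have g0 : g != 0 by exact: monic_neq0.
have eqw : g * v + h * u = w.
  rewrite /v /u mulrDr -addrA (mulrCA g h) -mulrDr (mulrC g (_ %/ _)) -divp_eq.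
  by rewrite !mulrA (mulrC g) (mulrC h) -mulrDl ab mul1r.
have su : (size u <= p)%N by rewrite -ltnS -gp ltn_modp.
exists (u, v); split=> //=.
have [->|v0] := eqVneq v 0; first by rewrite size_poly0.
have : (size (g * v)%R <= p + q)%N.
  rewrite -[g * v](addrK (h * u)) eqw (leq_trans (size_polyD _ _)) // geq_max wpq size_polyN.
  rewrite (leq_trans (size_polyMleq _ _)) // hq addSn /= addnC leq_add2r //.
by rewrite size_mul // gp addSn /= leq_add2l.
Qed.

(** A truncated l^1 norm. It is submultiplicative because the coefficients of a product below degree
    n involve only those of the factors below degree n. *)
Definition nrm n (p : {poly R}) : R := \sum_(i < n) `|p`_i|.

Lemma nrm_ge0 n p : 0 <= nrm n p. Proof. by rewrite sumr_ge0. Qed.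

Lemma nrm0 n : nrm n 0 = 0.
Proof. by rewrite /nrm big1 // => i _; rewrite coef0 normr0. Qed.

Lemma nrm_sub n (p q : {poly R}) : nrm n (p - q) <= nrm n p + nrm n q.
Proof.
rewrite /nrm -big_split /=; apply: ler_sum => i _.
by rewrite coefB; exact: ler_normB.
Qed.

Lemma nrm_sum n (I : Type) (s : seq I) (F : I -> {poly R}) :
  nrm n (\sum_(i <- s) F i) <= \sum_(i <- s) nrm n (F i).
Proof.
rewrite /nrm exchange_big /=; apply: ler_sum => i _.
by rewrite coef_sum; exact: ler_norm_sum.
Qed.

Lemma nrmZ n c (p : {poly R}) : nrm n (c *: p) = `|c| * nrm n p.
Proof. by rewrite /nrm mulr_sumr; apply: eq_bigr => i _; rewrite coefZ normrM. Qed.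

Lemma nrmM n (p q : {poly R}) : nrm n (p * q) <= nrm n p * nrm n q.
Proof.
apply: le_trans (sum_conv_le n (fun i => normr_ge0 p`_i) (fun i => normr_ge0 q`_i)).
apply: ler_sum => l _; rewrite coefM; apply: (le_trans (ler_norm_sum _ _ _)).
by apply: ler_sum => j _; rewrite normrM.
Qed.

Lemma coef_le_nrm n (p : {poly R}) i : (size p <= n)%N -> `|p`_i| <= nrm n p.
Proof.
move=> pn; have [iin|ni] := ltnP i n; last by rewrite nth_default ?normr0 ?nrm_ge0 // (leq_trans pn).
by rewrite /nrm (bigD1 (Ordinal iin)) //= lerDl sumr_ge0.
Qed.

(** Solving for the monomials X^j and extending linearly makes the solution operator linear on a
    finite-dimensional space, whence the uniform constant C. *)
Lemma linear_solver (n p q : nat) (g h : {poly R}) :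
  (forall w : {poly R}, (size w <= n)%N -> exists uv : {poly R} * {poly R},
    [/\ (size uv.1 <= p)%N, (size uv.2 <= q)%N & g * uv.2 + h * uv.1 = w]) ->
  exists (U : {poly R} -> {poly R} * {poly R}) (C : R), 0 < C /\
    forall w : {poly R}, (size w <= n)%N ->
    [/\ (size (U w).1 <= p)%N, (size (U w).2 <= q)%N, g * (U w).2 + h * (U w).1 = w &
       nrm n (U w).1 + nrm n (U w).2 <= C * nrm n w].
Proof.
move=> sol.
have /choice[E hE] (j : nat) : exists uv : {poly R} * {poly R}, (j < n)%N ->
    [/\ (size uv.1 <= p)%N, (size uv.2 <= q)%N & g * uv.2 + h * uv.1 = 'X^j].
  have [jn|_] := boolP (j < n)%N; last by exists (0, 0).
  by have [|uv huv] := sol 'X^j; [rewrite size_polyXn | exists uv].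
pose C := 1 + \sum_(j < n) (nrm n (E j).1 + nrm n (E j).2).
have E0 j : 0 <= nrm n (E j).1 + nrm n (E j).2 by rewrite addr_ge0 // nrm_ge0.
exists (fun w => (\sum_(j < n) w`_j *: (E j).1, \sum_(j < n) w`_j *: (E j).2)), C.
split=> [|w wn]; first by rewrite ltr_wpDr // sumr_ge0.
split=> /=.
- apply: (leq_trans (size_sum _ _ _)); apply/bigmax_leqP => j _.
  by have [h1 _ _] := hE j (ltn_ord j); apply: leq_trans (size_scale_leq _ _) h1.
- apply: (leq_trans (size_sum _ _ _)); apply/bigmax_leqP => j _.
  by have [_ h1 _] := hE j (ltn_ord j); apply: leq_trans (size_scale_leq _ _) h1.
- rewrite !mulr_sumr -big_split /=.
  transitivity (\poly_(j < n) w`_j); last first.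
    apply/polyP => i; rewrite coef_poly; case: ltnP => // ni.
    by rewrite nth_default // (leq_trans wn).
  rewrite poly_def; apply: eq_bigr => j _.
  have [_ _ <-] := hE j (ltn_ord j).
  by rewrite -!scalerAr scalerDr.
- apply: (le_trans (lerD (nrm_sum _ _ _) (nrm_sum _ _ _))).
  rewrite -big_split /= [leRHS]mulr_sumr; apply: ler_sum => j _.
  rewrite !nrmZ -mulrDr mulrC ler_wpM2r //.
  by rewrite /C (bigD1 j) //= addrCA lerDl addr_ge0 ?ler01 // sumr_ge0.
Qed.

(** Power series in t with polynomial coefficients: [c m] is the coefficient of t^m. *)
Definition ppsg (c : nat -> {poly R}) (P : R -> {poly R}) :=
  forall i, psg (fun m => (c m)`_i) (fun t => (P t)`_i).

Lemma ppsgD c d P Q : ppsg c P -> ppsg d Q -> ppsg (fun m => c m + d m) (fun t => P t + Q t).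
Proof.
move=> cP dQ i; apply: (eq_psg _ _ (psgD (cP i) (dQ i))) => [m|t]; by rewrite coefD.
Qed.

Lemma ppsgM c d P Q : ppsg c P -> ppsg d Q ->
  ppsg (fun m => \sum_(j < m.+1) c j * d (m - j)%N) (fun t => P t * Q t).
Proof.
move=> cP dQ i.
have := @psg_sum R i.+1 _ _ (fun j _ => psgM (cP j) (dQ (i - j)%N)).
apply: eq_psg => [m|t]; last by rewrite coefM.
rewrite coef_sum exchange_big /=; apply: eq_bigr => j _.
by rewrite coefM.
Qed.

Lemma ppsg_mull c P (q : {poly R}) : ppsg c P -> ppsg (fun m => q * c m) (fun t => q * P t).
Proof.
move=> cP i.
have := @psg_sum R i.+1 _ _ (fun j _ => psgZ q`_j (cP (i - j)%N)).
by apply: eq_psg => [m|t]; rewrite coefM.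
Qed.

Lemma ppsg_const (q : {poly R}) : ppsg (fun m => if m is 0%N then q else 0) (fun=> q).
Proof.
move=> i; apply: eq_psg (psg_const q`_i) => // -[|m] //; by rewrite coef0.
Qed.

Lemma ppsg_exists (c : nat -> {poly R}) n p (K r : R) : (p <= n)%N -> (forall m, (size (c m) <= p)%N) -> 0 <= r ->
  (forall m, nrm n (c m) <= K * r ^+ m) ->
  exists P, ppsg c P /\ forall t, (size (P t) <= p)%N.
Proof.
move=> pn cp r0 cK.
have /choice[f hf] (i : nat) : exists f, psg (fun m => (c m)`_i) f.
  have [|f [hf _]] := @geometric_bound_psg R (fun m => (c m)`_i) K r _ r0; last by exists f.
  by move=> m; apply: le_trans (cK m); apply: coef_le_nrm; apply: leq_trans pn.
exists (fun t => \poly_(i < p) f i t); split=> [i|t]; last exact: size_poly.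
have [ip|pi] := ltnP i p.
  by apply: eq_psg (hf i) => // t; rewrite coef_poly ip.
apply: eq_psg (psg0 R) => [m|t]; last by rewrite coef_poly ltnNge pi.
by rewrite nth_default // (leq_trans (cp m)).
Qed.

Lemma bound_nrm (n : nat) (a : nat -> nat -> R) (f : nat -> R -> R) :
  (forall i, psg (a i) (f i)) -> exists K r : R, [/\ 0 < K, 0 < r &
    forall m, nrm n (\poly_(i < n) a i m) <= K * r ^+ m].
Proof.
move=> af; have /choice[Kr hKr] (i : nat) : exists Kr : R * R, [/\ 0 < Kr.1, 0 < Kr.2 &
    forall m, `|a i m| <= Kr.1 * Kr.2 ^+ m].
  by have [K [r h]] := psg_geometric_bound (af i); exists (K, r).
have K0 i : 0 <= (Kr i).1 by have [/ltW] := hKr i.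
have r0 i : 0 <= (Kr i).2 by have [_ /ltW] := hKr i.
exists (1 + \sum_(i < n) (Kr i).1), (1 + \sum_(i < n) (Kr i).2).
split; [by rewrite ltr_wpDr // sumr_ge0|by rewrite ltr_wpDr // sumr_ge0|move=> m].
apply: (@le_trans _ _ (\sum_(i < n) (Kr i).1 * (1 + \sum_(i < n) (Kr i).2) ^+ m)).
  apply: ler_sum => i _; rewrite coef_poly ltn_ord.
  have [_ _ h] := hKr i; apply: (le_trans (h m)); rewrite ler_wpM2l // lerXn2r ?nnegrE //.
    by rewrite addr_ge0 // sumr_ge0.
  by rewrite (bigD1 i) //= addrCA lerDl addr_ge0 // sumr_ge0.
rewrite -mulr_suml ler_wpM2r ?exprn_ge0 ?addr_ge0 ?ler01 ?sumr_ge0 //.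
by rewrite lerDr.
Qed.

(** The factors are sought as g + sum of u_m t^m and h + sum of v_m t^m over m >= 1, with deg u_m <
    deg g and deg v_m < deg h. Comparing coefficients of t^m gives g v_m + h u_m = f_m - sum of u_i
    v_(m-i) over 0 < i < m, which is solvable by coprimality; the norms of the solutions then
    satisfy a quadratic recursion. In the proof [gh m] is the pair (u_m, v_m). *)
Lemma hensel (S : R -> {poly R}) (g h : {poly R}) :
  goodp (@an R) S -> g \is monic -> h \is monic -> coprimep g h -> S 0 = g * h ->
  (\forall t \near (0 : R), S t \is monic /\ size (S t) = size (g * h)) ->
  exists G H : R -> {poly R}, [/\ goodp (@an R) G, goodp (@an R) H,
    forall t, G t \is monic /\ size (G t) = size g,
    forall t, H t \is monic /\ size (H t) = size h &
    \forall t \near (0 : R), S t = G t * H t].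
Proof.
move=> anS gm hm cop S0 Sm.
have [p gp] : exists p, size g = p.+1.
  by exists (size g).-1; rewrite prednK // size_poly_gt0 monic_neq0.
have [q hq] : exists q, size h = q.+1.
  by exists (size h).-1; rewrite prednK // size_poly_gt0 monic_neq0.
pose n := (p + q)%N.
have ghn : size (g * h) = n.+1 by rewrite size_monicM ?monic_neq0 // gp hq addSn addnS.
have /choice[a ha] (i : nat) : exists a, psg a (fun t => (S t)`_i) := anS i.
(* The coefficient of X^n is left out: it equals 1 near 0 and contributes nothing at orders m >
   0. *)
pose f m : {poly R} := \poly_(i < n) a i m.
have [Kf [rf [Kf0 rf0 fK]]] := bound_nrm n ha.
have [U [C [C0 hU]]] := linear_solver (fun w => @bezout_bounded g h w p q gm hm gp hq cop).
(* The index i = 0 reads past the end of the prefix and returns the default, but its first factor is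
   u_0 = 0. *)
pose W (s : seq ({poly R} * {poly R})) :=
  f (size s) - \sum_(i < size s) (nth (0, 0) s i).1 * (nth (0, 0) s (size s - i)).2.
have [gh ghE] := prefix_rec (fun s => if s is [::] then (0, 0) else U (W s)).
have gh0 : gh 0%N = (0, 0) by rewrite ghE.
pose w m := f m - \sum_(i < m) (gh i).1 * (gh (m - i)%N).2.
have ghS m : gh m.+1 = U (w m.+1).
  rewrite ghE /mkseq /= -[_ :: _]/(mkseq gh m.+1); congr U.
  rewrite /W /w size_mkseq; congr (_ - _); apply: eq_bigr => i _.
  rewrite nth_mkseq //; have [->|i0] := posnP i; first by rewrite gh0 !mul0r.
  by rewrite nth_mkseq // ltn_subrL i0.
have sz m : ((size (gh m).1 <= p)%N /\ (size (gh m).2 <= q)%N) /\ (size (w m) <= n)%N.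
  elim/ltn_ind: m => m ih.
  have szw : (size (w m) <= n)%N.
    rewrite (leq_trans (size_polyD _ _)) // geq_max size_poly size_polyN.
    apply: (leq_trans (size_sum _ _ _)); apply/bigmax_leqP => i _.
    have [->|i0] := posnP i; first by rewrite gh0 mul0r size_poly0.
    apply: (leq_trans (size_polyMleq _ _)).
    have [[h1 _] _] := ih i (ltn_ord i).
    have [|[_ h2] _] := ih (m - i)%N; first by rewrite ltn_subrL i0 (leq_trans i0) // ltnW.
    by rewrite (leq_trans (leq_pred _)) // leq_add.
  split=> //; case: m szw {ih} => [|m] szw; first by rewrite gh0 size_poly0.
  by rewrite ghS; have [] := hU _ szw.
pose b m := nrm n (gh m).1 + nrm n (gh m).2.
have b0 m : 0 <= b m by rewrite addr_ge0 // nrm_ge0.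
have [K [r [r0 bK]]] : exists K' r' : R, 0 <= r' /\ forall m, b m <= K' * r' ^+ m.
  apply: (quadratic_majorant C0 Kf0 rf0) => //; first by rewrite /b gh0 /= nrm0 addr0.
  case=> // m _; rewrite {1}/b ghS.
  have [_ _ _ hb] := hU _ (sz m.+1).2; apply: (le_trans hb).
  rewrite ler_pM2l //; apply: (le_trans (nrm_sub _ _ _)); apply: lerD; first exact: fK.
  apply: (le_trans (nrm_sum _ _ _)); rewrite [leRHS]big_ord_recr /=.
  rewrite ler_wpDr ?mulr_ge0 //; apply: ler_sum => i _.
  apply: (le_trans (nrmM _ _ _)); apply: ler_pM; rewrite ?nrm_ge0 //.
    by rewrite /b lerDl nrm_ge0.
  by rewrite /b lerDr nrm_ge0.
have [G [cG szG]] : exists P, ppsg (fun m => (gh m).1) P /\ forall t, (size (P t) <= p)%N.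
  apply: (@ppsg_exists _ n p K r) => //; first exact: leq_addr.
    by move=> m; case: (sz m) => -[].
  by move=> m; apply: le_trans (bK m); rewrite /b lerDl nrm_ge0.
have [H [cH szH]] : exists P, ppsg (fun m => (gh m).2) P /\ forall t, (size (P t) <= q)%N.
  apply: (@ppsg_exists _ n q K r) => //; first exact: leq_addl.
    by move=> m; case: (sz m) => -[].
  by move=> m; apply: le_trans (bK m); rewrite /b lerDr nrm_ge0.
have Gm t : g + G t \is monic /\ size (g + G t) = size g.
  have lt : (size (G t) < size g)%N by rewrite gp ltnS.
  by rewrite monicE lead_coefDl // size_polyDl // -monicE.
have Hm t : h + H t \is monic /\ size (h + H t) = size h.
  have lt : (size (H t) < size h)%N by rewrite hq ltnS.
  by rewrite monicE lead_coefDl // size_polyDl // -monicE.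
exists (fun t => g + G t), (fun t => h + H t); split=> //.
- by move=> i; eexists; exact: (ppsgD (ppsg_const g) cG i).
- by move=> i; eexists; exact: (ppsgD (ppsg_const h) cH i).
have key : \forall t \near (0 : R), forall i : 'I_n, (S t)`_i = ((g + G t) * (h + H t))`_i.
  apply: (@filter_forall _ 'I_n (fun i t => (S t)`_i = ((g + G t) * (h + H t))`_i) (nbhs (0 : R))) => i.
  suff hGH : psg (a i) (fun t => ((g + G t) * (h + H t))`_i) by exact: psg_unique_near (ha i) hGH.
  have c1 := ppsgD (ppsgD (ppsg_const (g * h)) (ppsgD (ppsg_mull g cH) (ppsg_mull h cG))) (ppsgM cG cH).
  have := c1 i; apply: eq_psg => [m|t]; last first.
    by rewrite [in RHS]mulrDl [in RHS]mulrDr [in RHS]mulrDr addrA (mulrC h) !addrA addrAC.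
  case: m => [|m].
    by rewrite big_ord1 gh0 /= !mulr0 !addr0 -S0 -(psg_at0 (ha i)).
  have [_ _ hb _] := hU _ (sz m.+1).2.
  rewrite add0r big_ord_recr /= subnn gh0 /= mulr0 addr0 ghS hb subrK /f coef_poly ltn_ord //.
near=> t.
have [Smt Sst] : S t \is monic /\ size (S t) = size (g * h) by near: t.
have kt : forall i : 'I_n, (S t)`_i = ((g + G t) * (h + H t))`_i by near: t.
have [g1 g2] := Gm t; have [h1 h2] := Hm t.
have GHm : (g + G t) * (h + H t) \is monic by rewrite monicMr.
have GHs : size ((g + G t) * (h + H t)) = n.+1.
  by rewrite size_monicM ?monic_neq0 // g2 h2 gp hq addSn addnS.
apply/polyP => i; have [iin|ni|->] := ltngtP i n.
- exact: (kt (Ordinal iin)).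
- by rewrite !nth_default // ?GHs // Sst ghn.
- move/monicP: Smt; move/monicP: GHm; rewrite /lead_coef GHs Sst ghn /=.
  by move=> -> ->.
Unshelve. all: by end_near. Qed.

End Hensel.

(** * Real-rooted polynomials *)

Section RealRooted.
Variable R : realType.
Implicit Types (s : seq R).

Definition pXs s : {poly R} := \prod_(x <- s) ('X - x%:P).
Definition real_rooted (p : {poly R}) := exists s, p = pXs s.

Lemma size_pXs s : size (pXs s) = (size s).+1.
Proof. exact: size_prod_XsubC. Qed.

Lemma monic_pXs s : pXs s \is monic.
Proof. exact: monic_prod_XsubC. Qed.

Lemma pXs_cons x s : pXs (x :: s) = ('X - x%:P) * pXs s.
Proof. by rewrite /pXs big_cons. Qed.

Lemma coef_pXs_cons x s i : (pXs (x :: s))`_i =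
  (if i is j.+1 then (pXs s)`_j else 0) - x * (pXs s)`_i.
Proof.
by rewrite pXs_cons mulrBl coefB coefXM coefCM; case: i.
Qed.

Lemma coef_pXs_sum s i : size s = i.+1 -> (pXs s)`_i = - \sum_(x <- s) x.
Proof. by move=> si; rewrite -coefPn_prod_XsubC si. Qed.

(** Newton's identity 2 e_2 = p_1^2 - p_2 between elementary symmetric functions and power sums. *)
Lemma coef_pXs_sqr s i : size s = i.+2 ->
  2 * (pXs s)`_i = (\sum_(x <- s) x) ^+ 2 - \sum_(x <- s) x ^+ 2.
Proof.
elim: s i => // x s ih i [si]; rewrite coef_pXs_cons (coef_pXs_sum si) !big_cons.
case: i si => [|i] si.
  case: s si {ih} => // y [|//] _; rewrite !big_cons !big_nil; ring.
by rewrite mulrDr (ih _ si); ring.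
Qed.

Lemma coef_pXs_bound s (B : R) i : 0 <= B -> (forall x, x \in s -> `|x| <= B) ->
  `|(pXs s)`_i| <= (1 + B) ^+ size s.
Proof.
move=> B0; elim: s i => [|x s ih] i sB.
  by rewrite /pXs big_nil coef1 expr0; case: (i == 0%N); rewrite ?normr1 ?normr0.
have {}ih j : `|(pXs s)`_j| <= (1 + B) ^+ size s.
  by apply: ih => y ys; apply: sB; rewrite inE ys orbT.
rewrite coef_pXs_cons exprS mulrDl mul1r; apply: (le_trans (ler_normB _ _)).
apply: lerD; first by case: i => [|i] //; rewrite normr0 exprn_ge0 // addr_ge0.
by rewrite normrM ler_pM // sB // mem_head.
Qed.

(** Up to sign the coefficient of X^i is the elementary symmetric function of degree j = size s - i,
    hence homogeneous of degree j in the roots. *)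
Lemma coef_pXs_scale s (c : R) i j : (i + j)%N = size s ->
  (pXs [seq c * x | x <- s])`_i = c ^+ j * (pXs s)`_i.
Proof.
elim: s i j => [|x s ih] i j /= ij.
  by move/eqP: ij; rewrite addn_eq0 => /andP[_ /eqP->]; rewrite mul1r.
rewrite !coef_pXs_cons mulrBr; congr (_ - _).
  case: i ij => [|i] ij; first by rewrite mulr0.
  by apply: ih; case: ij.
case: j ij => [|j] ij.
  rewrite addn0 in ij; rewrite !nth_default ?mulr0 ?size_pXs ?size_map ?ij //.
rewrite (ih _ j) ?exprS; first by ring.
by move: ij; rewrite addnS => -[].
Qed.

Lemma pXs_shift s (c : R) : pXs s \Po ('X + c%:P) = pXs [seq x - c | x <- s].
Proof.
elim: s => [|x s ih]; first by rewrite /pXs !big_nil comp_polyC.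
rewrite /= !pXs_cons comp_polyM ih; congr (_ * _).
by rewrite comp_polyB comp_polyX comp_polyC polyCB; ring.
Qed.

(** A divisor of a product of linear factors is the product of some of them; this is how Hensel
    factors inherit real-rootedness. *)
Lemma real_rooted_mull (p q : {poly R}) : p \is monic -> real_rooted (p * q) -> real_rooted p.
Proof.
move=> pm [s pq]; have : p %| pXs s by rewrite -pq dvdp_mulIl.
move=> /dvdp_prod_XsubC[m]; rewrite eqp_monic //; last exact: monic_prod_XsubC.
by move/eqP => ->; exists (mask m s).
Qed.

Lemma monic_eq_coef (p q : {poly R}) n : p \is monic -> q \is monic ->
  size p = n.+1 -> size q = n.+1 -> (forall i : 'I_n, p`_i = q`_i) -> p = q.
Proof.
move=> pm qm sp sq pq; apply/polyP => i; have [iin|ni|->] := ltngtP i n.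
- exact: (pq (Ordinal iin)).
- by rewrite !nth_default // ?sp ?sq.
- by move/monicP: pm; move/monicP: qm; rewrite /lead_coef sp sq /= => -> ->.
Qed.

Lemma goodp_punct n (P Q : R -> {poly R}) : goodp (@an R) P -> goodp (@an R) Q ->
  (\forall t \near (0 : R), P t \is monic /\ size (P t) = n.+1) ->
  (\forall t \near (0 : R), Q t \is monic /\ size (Q t) = n.+1) ->
  (\forall t \near (0 : R), t != 0 -> P t = Q t) -> \forall t \near (0 : R), P t = Q t.
Proof.
move=> aP aQ mP mQ PQ.
have key : \forall t \near (0 : R), forall i : 'I_n, (P t)`_i = (Q t)`_i.
  apply: (@filter_forall _ 'I_n (fun i t => (P t)`_i = (Q t)`_i) (nbhs (0 : R))) => i.
  by apply: an_punct => //; apply: filterS PQ => t h t0; rewrite h.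
near=> t.
have [m1 s1] : P t \is monic /\ size (P t) = n.+1 by near: t.
have [m2 s2] : Q t \is monic /\ size (Q t) = n.+1 by near: t.
by apply: (monic_eq_coef m1 m2 s1 s2); near: t.
Unshelve. all: by end_near. Qed.

(* Compactness: if S 0 had no root in [-B, B], |S 0| would be bounded below there. *)
Lemma limit_root (S : R -> {poly R}) n (B : R) : goodp (@an R) S -> 0 <= B ->
  (\forall t \near (0 : R), size (S t) = n.+1) ->
  (\forall t \near (0 : R), t != 0 -> exists2 x, `|x| <= B & root (S t) x) ->
  exists x, root (S 0) x.
Proof.
move=> aS B0 sS rS; apply: contrapT => nr.
have [||c _ cmin] := @EVT_min R (fun x => `|(S 0).[x]|) (- B) B.
- by rewrite -subr_ge0 opprK addr_ge0.
- apply: continuous_subspaceT => x.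
  by apply: (@cvg_norm _ _ R); exact: continuous_horner.
set d := `|(S 0).[c]| in cmin.
have d0 : 0 < d.
  by rewrite normr_gt0; apply/negP => rc; apply: nr; exists c.
(* With this tolerance each of the n + 1 coefficients changes the value on [-B, B] by less than d /
   (n + 1); the summand 1 keeps the estimate strict and the denominator positive. *)
pose e i := d / (n.+1%:R * (1 + B ^+ i)).
have e0 i : 0 < e i by rewrite divr_gt0 // mulr_gt0 ?ltr0n // ltr_wpDr ?exprn_ge0.
have h : \forall t \near (0 : R), forall i : 'I_n.+1, `|(S t)`_i - (S 0)`_i| < e i.
  apply: (@filter_forall _ 'I_n.+1 (fun i t => `|(S t)`_i - (S 0)`_i| < e i) (nbhs (0 : R))) => i.
  exact: (an_cvg0 (aS i)).
have : \forall t \near (0 : R), [/\ forall i : 'I_n.+1, `|(S t)`_i - (S 0)`_i| < e i,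
   size (S t) = n.+1 & t != 0 -> exists2 x, `|x| <= B & root (S t) x].
  by near=> t; split; near: t.
move=> /near0_pos[t t0 [[h1 h2 /(_ (lt0r_neq0 t0))[x xB /eqP xr]] _]].
have := cmin x; rewrite in_itv /= -ler_norml xB => /(_ isT).
have s0 : size (S 0) = n.+1 by exact: nbhs_singleton sS.
have -> : (S 0).[x] = - ((S t).[x] - (S 0).[x]) by rewrite xr sub0r opprK.
rewrite normrN (@horner_coef_wide _ n.+1) ?h2 // (@horner_coef_wide _ n.+1 (S 0)) ?s0 // -sumrB leNgt => /negP; apply.
apply: (le_lt_trans (ler_norm_sum _ _ _)).
apply: (@lt_le_trans _ _ (\sum_(i < n.+1) d / n.+1%:R)); last first.
  by rewrite sumr_const card_ord -(mulr_natr (d / _)) divfK // pnatr_eq0.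
apply: ltr_sum; first by apply/hasP; exists ord0; rewrite ?mem_index_enum.
move=> i _; rewrite -mulrBl normrM normrX.
apply: (@le_lt_trans _ _ (e i * B ^+ i)).
  by rewrite ler_pM ?exprn_ge0 ?(ltW (h1 i)) // lerXn2r ?nnegrE.
rewrite /e invfM mulrA -mulrA gtr_pMr ?divr_gt0 ?ltr0n //.
rewrite mulrC ltr_pdivrMr ?mul1r; first by rewrite ltrDr.
by rewrite ltr_wpDr ?exprn_ge0.
Unshelve. all: by end_near. Qed.

(** A real root x0 of [S 0], taken with its full multiplicity m, gives coprime factors (X - x0)^m
    and q. The two conditions on the coefficients of [S 0] exclude that q is constant. *)
Lemma real_rooted_splitting (S : R -> {poly R}) i (B : R) : goodp (@an R) S -> 0 <= B ->
  (\forall t \near (0 : R), S t \is monic /\ size (S t) = i.+3) ->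
  (\forall t \near (0 : R), t != 0 -> exists2 s, S t = pXs s & forall x, x \in s -> `|x| <= B) ->
  (S 0)`_i.+1 = 0 -> (S 0)`_i != 0 ->
  exists p q (G H : R -> {poly R}), [/\ [/\ (p < i.+2)%N, (q < i.+2)%N & (p + q = i.+2)%N],
    goodp (@an R) G /\ goodp (@an R) H,
    forall t, G t \is monic /\ size (G t) = p.+1,
    forall t, H t \is monic /\ size (H t) = q.+1 &
    \forall t \near (0 : R), S t = G t * H t].
Proof.
move=> aS B0 mS rS c1 c2.
have [m0 s0] := nbhs_singleton mS.
have [x0 rx] : exists x, root (S 0) x.
  apply: (limit_root (n := i.+2) aS B0); first by apply: filterS mS => t [_ ->].
  near=> t => t0.
  have sz : size (S t) = i.+3 by have [] : S t \is monic /\ size (S t) = i.+3 by near: t.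
  have [s Ss sB] : exists2 s, S t = pXs s & forall x, x \in s -> `|x| <= B.
    by move: t0; near: t.
  case: s Ss sB => [|x s] Ss sB; first by move: sz; rewrite Ss size_pXs.
  exists x; first by apply: sB; rewrite mem_head.
  by rewrite Ss root_prod_XsubC mem_head.
have [m [q]] := multiplicity_XsubC (S 0) x0.
rewrite monic_neq0 //= => rq Sq.
have Xm : ('X - x0%:P) ^+ m \is monic by rewrite monic_exp // monicXsubC.
have qm : q \is monic by move: m0; rewrite Sq monicMr.
have sXm : size (('X - x0%:P) ^+ m) = m.+1 by rewrite size_exp_XsubC.
have mpos : (0 < m)%N.
  by case: m Sq {Xm sXm} => // Sq; move: rx; rewrite Sq expr0 mulr1 (negbTE rq).
(* Otherwise all roots equal x0; their sum is 0, so x0 = 0, and the coefficient of X^i would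
   vanish. *)
have sq : size q != 1%N.
  apply/negP => /eqP q1.
  have {}Sq : S 0 = pXs (nseq m x0).
    rewrite /pXs big_nseq.
    have /size_poly1P[c _ qc] : size q == 1%N by rewrite q1.
    move: qm; rewrite Sq qc monicE lead_coefC => /eqP ->.
    by rewrite mul1r; elim: (m) => //= k <-; rewrite exprS.
  have mi : m = i.+2 by move: s0; rewrite Sq size_pXs size_nseq => -[].
  have := @coef_pXs_sum (nseq m x0) i.+1; rewrite size_nseq => /(_ mi).
  rewrite -Sq c1 big_nseq => e1.
  have := @coef_pXs_sqr (nseq m x0) i; rewrite size_nseq => /(_ mi).
  rewrite -Sq !big_nseq => e2.
  have x00 : x0 = 0.
    apply/eqP; move/eqP: e1; rewrite eq_sym oppr_eq0 iter_addr_0 mulrn_eq0 mi.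
    by [].
  move: e2; rewrite x00 expr0n /= !iter_addr_0 !mul0rn expr0n /= subr0 => /eqP.
  by rewrite mulf_eq0 (negbTE c2) pnatr_eq0.
have cop : coprimep (('X - x0%:P) ^+ m) q.
  by rewrite coprimep_expl // coprimep_sym coprimep_XsubC.
have [k sqk] : exists k, size q = k.+1.
  by exists (size q).-1; rewrite prednK // size_poly_gt0 monic_neq0.
have sgh : size (('X - x0%:P) ^+ m * q) = i.+3 by rewrite mulrC -Sq s0.
have mk : (m + k = i.+2)%N.
  by move: sgh; rewrite size_monicM ?monic_neq0 // sXm sqk addSn addnS /= => -[].
have [||G [H [aG aH hG hH SGH]]] := hensel aS Xm qm cop; first by rewrite mulrC.
  by rewrite sgh.
have k0 : (0 < k)%N by rewrite lt0n; apply: contra sq => /eqP k0; rewrite sqk k0.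
exists m, k, G, H; split=> //.
- by split=> //; lia.
- by move=> t; rewrite -sXm.
- by move=> t; rewrite -sqk.
Unshelve. all: by end_near. Qed.

(** Dividing the roots by t^m divides coefficient j by t^(m (n - j)); the bound on the roots makes
    that coefficient divisible as a germ. Prescribing coefficients instead of roots gives [S] a
    meaning at t = 0. *)
Lemma scale_family n (Q : R -> {poly R}) m (B : R) : goodp (@an R) Q -> 0 <= B ->
  (\forall t \near (0 : R), Q t \is monic /\ size (Q t) = n.+1) ->
  (\forall t \near (0 : R), t != 0 ->
     exists2 s, Q t = pXs s & forall x, x \in s -> `|x| <= B * `|t| ^+ m) ->
  exists S : R -> {poly R}, [/\ goodp (@an R) S,
    forall t, S t \is monic /\ size (S t) = n.+1,
    \forall t \near (0 : R), t != 0 ->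
      exists2 s, S t = pXs s & forall x, x \in s -> `|x| <= B &
    \forall t \near (0 : R), forall j : 'I_n, (Q t)`_j = (t ^+ m) ^+ (n - j) * (S t)`_j].
Proof.
move=> aQ B0 mQ rQ.
have rQ' : \forall t \near (0 : R), t != 0 -> exists ys, [/\ size ys = n,
    forall x, x \in ys -> `|x| <= B &
    forall j : nat, (j <= n)%N -> (Q t)`_j = (t ^+ m) ^+ (n - j) * (pXs ys)`_j].
  near=> t => t0.
  have [_ sz] : Q t \is monic /\ size (Q t) = n.+1 by near: t.
  have [s Qs sB] : exists2 s, Q t = pXs s & forall x, x \in s -> `|x| <= B * `|t| ^+ m.
    by move: t0; near: t.
  have tm0 : t ^+ m != 0 by rewrite expf_eq0 (negbTE t0) andbF.
  have ss : size s = n by move: sz; rewrite Qs size_pXs => -[].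
  exists [seq x / t ^+ m | x <- s]; split; first by rewrite size_map.
    move=> _ /mapP[x xs ->]; rewrite normrM normfV normrX ler_pdivrMr ?sB //.
    by rewrite exprn_gt0 // normr_gt0.
  move=> j jn; have <- : (pXs [seq t ^+ m * x | x <- [seq x / t ^+ m | x <- s]])`_j =
      (t ^+ m) ^+ (n - j) * (pXs [seq x / t ^+ m | x <- s])`_j.
    by apply: coef_pXs_scale; rewrite size_map ss subnKC.
  rewrite Qs -map_comp; congr (pXs _)`_j; rewrite -[LHS]map_id.
  by apply: eq_map => x /=; rewrite mulrCA divff // mulr1.
have /choice[r hr] (j : nat) : exists r, an r /\ ((j < n)%N ->
    \forall t \near (0 : R), (Q t)`_j = (t ^+ m) ^+ (n - j) * r t).
  have [jn|_] := boolP (j < n)%N; last first.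
    by exists (fun=> 0); split => //; have [cst _ _] := an_closed R; exact: cst.
  have [|r ar rE] := @an_div R (fun t => (Q t)`_j) (m * (n - j)) ((1 + B) ^+ n) (aQ j).
    apply: filterS rQ' => t h /h[ys [ss yB ->]]; last exact: ltnW.
    rewrite normrM -exprM normrX mulrC ler_wpM2r ?exprn_ge0 // -ss.
    exact: coef_pXs_bound.
  exists r; split=> // _; apply: filterS rE => t ->; by rewrite exprM.
pose S t : {poly R} := 'X^n + \poly_(j < n) r j t.
have Sm t : S t \is monic /\ size (S t) = n.+1.
  have lt : (size (\poly_(j < n) r j t)%R < size ('X^n : {poly R}))%N.
    by rewrite size_polyXn ltnS size_poly.
  by rewrite monicE lead_coefDl // size_polyDl // size_polyXn lead_coefXn.
have aS : goodp (@an R) S.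
  have [cst add mul] := an_closed R.
  move=> j; rewrite /S; under eq_fun do rewrite coefD coefXn coef_poly.
  apply: add; first exact: cst.
  by case: ltnP => _; [have [] := hr j|exact: cst].
have QS : \forall t \near (0 : R), forall j : 'I_n, (Q t)`_j = (t ^+ m) ^+ (n - j) * (S t)`_j.
  apply: (@filter_forall _ 'I_n (fun j t => (Q t)`_j = (t ^+ m) ^+ (n - j) * (S t)`_j) (nbhs (0 : R))) => j.
  have [_ /(_ (ltn_ord j))] := hr j; apply: filterS => t ->.
  by rewrite /S coefD coefXn coef_poly ltn_ord ltn_eqF // add0r.
exists S; split=> //.
near=> t => t0.
have [ys [ss yB yE]] : exists ys, [/\ size ys = n, forall x, x \in ys -> `|x| <= B &
    forall j : nat, (j <= n)%N -> (Q t)`_j = (t ^+ m) ^+ (n - j) * (pXs ys)`_j].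
  by move: t0; near: t.
exists ys => //; have [m1 s1] := Sm t.
apply: (monic_eq_coef m1 (monic_pXs ys) s1); first by rewrite size_pXs ss.
move=> j; have : (Q t)`_j = (t ^+ m) ^+ (n - j) * (S t)`_j.
  by move: j; near: t.
rewrite yE; last exact: ltnW.
move/(mulfI _) => -> //; by rewrite !expf_eq0 (negbTE t0) !andbF.
Unshelve. all: by end_near. Qed.

End RealRooted.

(** * Rellich's theorem for real-rooted families *)

Section Rellich.
Variable R : realType.

Definition pXf (fs : seq (R -> R)) t : {poly R} := \prod_(f <- fs) ('X - (f t)%:P).

Lemma pXf_map fs t : pXf fs t = pXs [seq f t | f <- fs].
Proof. by rewrite /pXs big_map. Qed.

Lemma goodp_shift n (P : R -> {poly R}) (c : R -> R) : goodp (@an R) P -> an c ->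
  (\forall t \near (0 : R), size (P t) = n.+1) ->
  exists2 Q, goodp (@an R) Q & \forall t \near (0 : R), Q t = P t \Po ('X + (c t)%:P).
Proof.
move=> aP ac sP; have acl := an_closed R; have gcl := goodp_closed acl.
exists (fun t => \sum_(i < n.+1) ((P t)`_i)%:P * ('X + (c t)%:P) ^+ i).
  apply: (closed_fun_sum gcl) => i _.
  have [cst add mul] := gcl.
  apply: mul; first exact: (goodpC acl (aP i)).
  by apply: (closed_funX gcl); apply: add; [exact: cst|exact: goodpC].
apply: filterS sP => t st; rewrite comp_polyE st.
by apply: eq_bigr => i _; rewrite mul_polyC.
Qed.

Lemma comp_shiftK (p : {poly R}) (c : R) : (p \Po ('X + c%:P)) \Po ('X + (- c)%:P) = p.
Proof.
by rewrite -comp_polyA comp_polyD comp_polyX comp_polyC -addrA -polyCD addNr addr0 comp_polyXr.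
Qed.

Lemma monic_comp_shift (p : {poly R}) n (c : R) : p \is monic -> size p = n.+1 ->
  p \Po ('X + c%:P) \is monic /\ size (p \Po ('X + c%:P)) = n.+1.
Proof.
move=> /monicP pm sp; rewrite size_comp_poly2 ?size_XaddC // sp; split=> //.
rewrite monicE lead_coef_comp ?size_XaddC // pm mul1r.
rewrite lead_coefDl ?size_polyX ?(leq_ltn_trans (size_polyC_leq1 _)) //.
by rewrite lead_coefX expr1n.
Qed.

Lemma even_order_of_nonpos (f g : R -> R) M : an g -> g 0 != 0 ->
  (\forall t \near (0 : R), f t = t ^+ M * g t) ->
  (\forall t \near (0 : R), t != 0 -> f t <= 0) ->
  exists m, M = (2 * m)%N.
Proof.
move=> ag g0 fg f0.
have : \forall t \near (0 : R), [/\ `|g t - g 0| < `|g 0| / 2,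
    f t = t ^+ M * g t & t != 0 -> f t <= 0].
  by near=> t; split; near: t => //; exact: an_nonzero.
move=> /near0_pos[t t0 [[h1 h2 h3] [h4 h5 h6]]].
have tn := lt0r_neq0 t0; have k2 := h3 tn; have := h6; rewrite oppr_eq0 => /(_ tn) k1.
have tM : 0 < t ^+ M by rewrite exprn_gt0.
exists M./2; rewrite mul2n; apply/eqP; rewrite eq_sym even_halfK //.
apply/negP => oM.
move: k1 k2; rewrite h2 h5 exprNn -signr_odd oM expr1 mulN1r mulNr oppr_le0 !pmulr_rle0 ?pmulr_rge0 //.
move: h1 h4; rewrite !ltr_norml => /andP[h11 h12] /andP[h41 h42] k1 k2.
move: g0; rewrite neq_lt => /orP[g0|g0].
  by rewrite (ltr0_norm g0) in h11 h12 h41 h42; lra.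
by rewrite (gtr0_norm g0) in h11 h12 h41 h42; lra.
Unshelve. all: by end_near. Qed.

(** Real-rootedness is asked only for t != 0, so that the induction hypothesis applies to the
    factors of the rescaled family, which is known to split only off 0. *)
Theorem rellich_poly n (P : R -> {poly R}) : goodp (@an R) P ->
  (\forall t \near (0 : R), P t \is monic /\ size (P t) = n.+1) ->
  (\forall t \near (0 : R), t != 0 -> real_rooted (P t)) ->
  exists fs : seq (R -> R), [/\ size fs = n, forall f, f \in fs -> an f &
    \forall t \near (0 : R), P t = pXf fs t].
Proof.
have acl := an_closed R; have [cst add mul] := acl.
elim/ltn_ind: n P => -[|[|i]] ih P aP mP rP.
- exists [::]; split=> //; apply: filterS mP => t [/monicP + s1].
  have /size_poly1P[c _ ->] : size (P t) == 1%N by rewrite s1.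
  by rewrite lead_coefC => ->; rewrite /pXf big_nil.
- exists [:: fun t => - (P t)`_0]; split=> //.
    by move=> f; rewrite inE => /eqP ->; apply: closed_funN.
  apply: filterS mP => t [/monicP m1 s1]; rewrite /pXf big_seq1 polyCN opprK.
  apply/polyP => -[|[|j]]; rewrite coefD coefX coefC /= ?add0r ?addr0 //.
    by move: m1; rewrite /lead_coef s1.
  by rewrite nth_default // s1.
set n := i.+2 in ih mP *.
(* The mean of the roots, by Vieta. *)
pose c t := - (P t)`_i.+1 / n%:R.
have ac : an c by apply: mul; [exact: closed_funN|exact: cst].
have [|Q aQ QP] := goodp_shift aP ac (n := n); first by apply: filterS mP => t [].
have mQ : \forall t \near (0 : R), Q t \is monic /\ size (Q t) = n.+1.
  near=> t; have [m1 s1] : P t \is monic /\ size (P t) = n.+1 by near: t.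
  have -> : Q t = P t \Po ('X + (c t)%:P) by near: t.
  exact: monic_comp_shift.
have PQ : \forall t \near (0 : R), P t = Q t \Po ('X + (- c t)%:P).
  by apply: filterS QP => t ->; rewrite comp_shiftK.
have conclude fs : size fs = n -> (forall f, f \in fs -> an f) ->
    (\forall t \near (0 : R), Q t = pXf fs t) ->
    exists fs : seq (R -> R), [/\ size fs = n, forall f, f \in fs -> an f &
      \forall t \near (0 : R), P t = pXf fs t].
  move=> sfs afs Qfs; exists [seq (fun t => f t + c t) | f <- fs]; split.
  - by rewrite size_map.
  - by move=> _ /mapP[f ffs ->]; apply: add => //; exact: afs.
  - near=> t; have -> : P t = Q t \Po ('X + (- c t)%:P) by near: t.
    have -> : Q t = pXf fs t by near: t.
    rewrite !pXf_map pXs_shift -!map_comp; congr pXs.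
    by apply: eq_map => f /=; rewrite opprK.
have rQ : \forall t \near (0 : R), t != 0 -> exists s, [/\ Q t = pXs s, size s = n & \sum_(x <- s) x = 0].
  near=> t => t0.
  have [m1 s1] : P t \is monic /\ size (P t) = n.+1 by near: t.
  have QPt : Q t = P t \Po ('X + (c t)%:P) by near: t.
  have [s Ps] : real_rooted (P t) by move: t0; near: t.
  have ss : size s = n by move: s1; rewrite Ps size_pXs => -[].
  exists [seq x - c t | x <- s]; split; last 1 first.
  - rewrite big_map sumrB big_const_seq count_predT iter_addr_0 -(mulr_natr (c t)) ss /c.
    by rewrite Ps (coef_pXs_sum ss) opprK divfK ?pnatr_eq0 // subrr.
  - by rewrite QPt Ps pXs_shift.
  - by rewrite size_map.
have e2 : \forall t \near (0 : R), t != 0 -> exists s, [/\ Q t = pXs s, size s = n,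
    (Q t)`_i.+1 = 0 & \sum_(x <- s) x ^+ 2 = - 2 * (Q t)`_i].
  apply: filterS rQ => t h /h[s [Qs ss s0]]; exists s; split => //.
    by rewrite Qs (coef_pXs_sum ss) s0 oppr0.
  by rewrite mulNr Qs (coef_pXs_sqr ss) s0 expr0n sub0r opprK.
(* If the coefficient of X^i vanishes near 0, the squares of the roots sum to 0 and Q is X^n;
   otherwise its order M drives the rescaling. *)
have [q0|[M [g [ag g0 qg]]]] := an_lead (aQ i).
  apply: (conclude (nseq n (fun=> 0))); first by rewrite size_nseq.
    by move=> f /nseqP[-> _]; exact: cst.
  have -> : pXf (nseq n (fun=> 0)) = fun=> 'X^n.
    apply/funext => t; rewrite /pXf big_nseq subr0.
    by elim: (n) => //= k ->; rewrite exprS.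
  apply: (goodp_punct (n := n)) => //.
  - by near=> t; rewrite monicXn size_polyXn.
  near=> t => t0.
  have [s [Qs ss _ sq]] : exists s, [/\ Q t = pXs s, size s = n,
      (Q t)`_i.+1 = 0 & \sum_(x <- s) x ^+ 2 = - 2 * (Q t)`_i].
    by move: t0; near: t.
  have qt0 : (Q t)`_i = 0 by near: t.
  move/eqP: sq; rewrite qt0 mulr0 psumr_eq0 => [/allP /= sx|x _]; last exact: sqr_ge0.
  rewrite Qs -ss /pXs (eq_big_seq (fun=> 'X)); last first.
    by move=> x /sx; rewrite sqrf_eq0 => /eqP ->; rewrite subr0.
  by rewrite big_const_seq count_predT; elim: (size s) => //= k ->; rewrite exprS.
have [m mE] : exists m, M = (2 * m)%N.
  apply: (even_order_of_nonpos ag g0 qg); apply: filterS e2 => t h /h[s [_ _ _ sq]].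
  have : 0 <= \sum_(x <- s) x ^+ 2 by apply: sumr_ge0 => x _; exact: sqr_ge0.
  by rewrite sq; lra.
(* Near 0 a root x satisfies x^2 <= 2 |g t| t^(2m) <= 3 |g 0| t^(2m), and 3 |g 0| <= B^2. *)
pose B := 1 + 3 * `|g 0|; have B0 : 0 <= B by rewrite addr_ge0 // mulr_ge0.
have [|S [aS mS rS QS]] := @scale_family R n Q m B aQ B0 mQ.
  near=> t => t0.
  have [s [Qs ss _ sq]] : exists s, [/\ Q t = pXs s, size s = n,
      (Q t)`_i.+1 = 0 & \sum_(x <- s) x ^+ 2 = - 2 * (Q t)`_i].
    by move: t0; near: t.
  have qt : (Q t)`_i = t ^+ M * g t by near: t.
  have gt : `|g t - g 0| < `|g 0| / 2 by near: t; exact: an_nonzero.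
  exists s => // x xs.
  rewrite -(ler_pXn2r (ltn0Sn 1)) ?nnegrE ?mulr_ge0 ?exprn_ge0 //.
  rewrite exprMn -exprM (mulnC m) -mE real_normK ?num_real //.
  apply: (@le_trans _ _ (\sum_(x <- s) x ^+ 2)).
    by rewrite (big_rem x) //= lerDl sumr_ge0 // => y _; exact: sqr_ge0.
  rewrite sq qt; apply: (le_trans (ler_norm _)).
  rewrite normrM normrM normrX normrN normr_nat mulrCA mulrC ler_wpM2r ?exprn_ge0 //.
  have gt2 : `|g t| <= 3 / 2 * `|g 0|.
    by have := ler_normD (g t - g 0) (g 0); rewrite subrK; lra.
  rewrite /B; have := normr_ge0 (g 0); nra.
have rS0 : (S 0)`_i.+1 = 0.
  have : \forall t \near (0 : R), (S t)`_i.+1 = (fun=> 0) t.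
    apply: an_punct => //; near=> t => t0.
    have [s [_ _ Q1 _]] : exists s, [/\ Q t = pXs s, size s = n,
        (Q t)`_i.+1 = 0 & \sum_(x <- s) x ^+ 2 = - 2 * (Q t)`_i].
      by move: t0; near: t.
    have QSt : forall j : 'I_n, (Q t)`_j = (t ^+ m) ^+ (n - j) * (S t)`_j by near: t.
    move/eqP: Q1; rewrite (QSt (Ordinal (ltnSn i.+1))) /= mulf_eq0 !expf_eq0 (negbTE t0) !andbF /=.
    by move/eqP.
  exact: nbhs_singleton.
(* The coefficient of X^(n-2) is divided by (t^m)^2 = t^M, exactly the power extracted from it, so
   what remains is g. *)
have rS1 : (S 0)`_i != 0.
  suff -> : (S 0)`_i = g 0 by [].
  apply: (@nbhs_singleton _ 0 (fun t => (S t)`_i = g t)); apply: an_punct => //.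
  near=> t => t0.
  have QSt : forall j : 'I_n, (Q t)`_j = (t ^+ m) ^+ (n - j) * (S t)`_j by near: t.
  have qt : (Q t)`_i = t ^+ M * g t by near: t.
  move: (QSt (Ordinal (leqnSn i.+1))); rewrite /= qt mE (_ : n - i = 2)%N; last by rewrite /n; lia.
  rewrite -exprM mulnC.
  by move/(mulfI _) => -> //; rewrite expf_eq0 (negbTE t0) !andbF.
have [p [q [G [H [[pn qn pq] [aG aH] mG mH SGH]]]]] : exists p q (G H : R -> {poly R}),
    [/\ [/\ (p < i.+2)%N, (q < i.+2)%N & (p + q = i.+2)%N],
    goodp (@an R) G /\ goodp (@an R) H,
    forall t, G t \is monic /\ size (G t) = p.+1,
    forall t, H t \is monic /\ size (H t) = q.+1 &
    \forall t \near (0 : R), S t = G t * H t].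
  by apply: (real_rooted_splitting aS B0 _ rS rS0 rS1); near=> t.
have [||fG [sG afG GE]] := ih p pn G aG _ _.
- by near=> t.
- near=> t => t0; have [m1 _] := mG t.
  have [s Ss _] : exists2 s, S t = pXs s & forall x, x \in s -> `|x| <= B.
    by move: t0; near: t.
  apply: (@real_rooted_mull _ _ (H t) m1); exists s; rewrite -Ss; apply/esym; near: t.
  exact: SGH.
have [||fH [sH afH HE]] := ih q qn H aH _ _.
- by near=> t.
- near=> t => t0; have [m1 _] := mH t.
  have [s Ss _] : exists2 s, S t = pXs s & forall x, x \in s -> `|x| <= B.
    by move: t0; near: t.
  apply: (@real_rooted_mull _ _ (G t) m1); exists s; rewrite -Ss mulrC; apply/esym; near: t.
  exact: SGH.
apply: (conclude [seq (fun t => t ^+ m * f t) | f <- fG ++ fH]).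
- by rewrite size_map size_cat sG sH.
- move=> _ /mapP[f ffs ->]; apply: mul; first exact: (closed_funX acl _ (@an_id R)).
  by move: ffs; rewrite mem_cat => /orP[/afG|/afH].
- near=> t; have [m1 s1] : Q t \is monic /\ size (Q t) = n.+1 by near: t.
  have QSt : forall j : 'I_n, (Q t)`_j = (t ^+ m) ^+ (n - j) * (S t)`_j by near: t.
  have St : S t = pXs [seq f t | f <- fG ++ fH].
    transitivity (G t * H t); first by near: t.
    rewrite /pXs big_map big_cat /=; congr (_ * _); by near: t.
  have szf : size [seq f t | f <- fG ++ fH] = n by rewrite size_map size_cat sG sH.
  have -> : pXf [seq (fun t => t ^+ m * f t) | f <- fG ++ fH] t =
      pXs [seq t ^+ m * x | x <- [seq f t | f <- fG ++ fH]].
    by rewrite pXf_map -!map_comp.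
  apply: (monic_eq_coef m1 (monic_pXs _) s1); first by rewrite size_pXs size_map szf.
  move=> j; rewrite QSt St (@coef_pXs_scale _ _ _ _ (n - j)) //.
  by rewrite szf subnKC // ltnW.
Unshelve. all: by end_near. Qed.

End Rellich.

(** * Eigenvalues of Hermitian families *)

Section Eigenvalues.
Variable R : realType.
Local Notation C := R[i].

Definition can (F : R -> C) := an (fun t => complex.Re (F t)) /\ an (fun t => complex.Im (F t)).

Lemma can_closed : closed_fun can.
Proof.
have acl := an_closed R; have [cst add mul] := acl.
split=> [c|F G [fr fi] [gr gi]|F G [fr fi] [gr gi]]; first by split; exact: cst.
- by split; [under eq_fun do rewrite raddfD|under eq_fun do rewrite raddfD]; exact: add.
- have ReM (x y : C) : complex.Re (x * y) = complex.Re x * complex.Re y - complex.Im x * complex.Im y.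
    by case: x; case: y.
  have ImM (x y : C) : complex.Im (x * y) = complex.Re x * complex.Im y + complex.Im x * complex.Re y.
    by case: x; case: y.
  split; [under eq_fun do rewrite ReM|under eq_fun do rewrite ImM].
    by apply: (closed_funB acl); exact: mul.
  by apply: add; exact: mul.
Qed.

Lemma goodp_char_poly n (H : R -> 'M[C]_n) : (forall i j, can (fun t => H t i j)) ->
  goodp can (fun t => char_poly (H t)).
Proof.
move=> hH; have gcl := goodp_closed can_closed; have [cst add mul] := gcl.
apply: (closed_fun_sum gcl) => s _; apply: mul; first exact: cst.
apply: (closed_fun_prod gcl) => i _.
under eq_fun do rewrite !mxE.
apply: (closed_funB gcl); first exact: cst.
by apply: goodpC => //; exact: can_closed.
Qed.

Lemma real_analytic_on_an (eps : R) (f : R -> R) : 0 < eps -> real_analytic_on eps f -> an f.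
Proof.
move=> e0 /(_ 0); rewrite normr0 => /(_ e0)[a [r r0 h]]; exists a.
near=> t; apply: h; first by rewrite subr0; near: t; exact: near0_lt.
by near: t; exact: near0_lt.
Unshelve. all: by end_near. Qed.

(** For a left eigenvector v with adjoint w, the scalar v H w = z (v w) is its own conjugate, and v
    w is a nonzero real number. *)
Lemma herm_eigenvalue_real n (H : 'M[C]_n) (z : C) : herm_mx H -> root (char_poly H) z ->
  z = (complex.Re z)%:C%C.
Proof.
move=> hH; rewrite -eigenvalue_root_char => /eigenvalueP[v vH v0].
pose adj (m p : nat) (A : 'M[C]_(m, p)) := (map_mx (@conjc R) A)^T.
have adjM m p q (A : 'M[C]_(m, p)) (B : 'M[C]_(p, q)) : adj _ _ (A *m B) = adj _ _ B *m adj _ _ A.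
  by rewrite /adj map_mxM trmx_mul.
have adjK m p (A : 'M[C]_(m, p)) : adj _ _ (adj _ _ A) = A.
  by apply/matrixP => i j; rewrite !mxE conjcK.
have cc : adj _ _ (v *m H *m adj _ _ v) = v *m H *m adj _ _ v.
  by rewrite !adjM adjK [adj _ _ H]hH mulmxA.
pose N := (v *m adj _ _ v) 0 0.
have NE : N = \sum_j ((complex.Re (v 0 j)) ^+ 2 + (complex.Im (v 0 j)) ^+ 2)%:C%C.
  rewrite /N mxE; apply: eq_bigr => j _; rewrite !mxE.
  case: (v 0 j) => a b; apply/eqP; rewrite eq_complex /=.
  by apply/andP; split; apply/eqP; ring.
have Nr : N^*%C = N.
  by rewrite NE rmorph_sum; apply: eq_bigr => j _; exact: conjc_real.
have N0 : N != 0.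
  apply: contra v0 => /eqP; rewrite NE -rmorph_sum => /(congr1 (@complex.Re R)) /= /eqP.
  rewrite psumr_eq0 => [/allP h|j _]; last by rewrite addr_ge0 ?sqr_ge0.
  apply/eqP/rowP => j; rewrite mxE.
  have := h j (mem_index_enum _); rewrite /= paddr_eq0 ?sqr_ge0 // !sqrf_eq0.
  by case: (v 0 j) => a b /= /andP[/eqP -> /eqP ->].
have zN : (z * N)^*%C = z * N.
  have -> : z * N = (v *m H *m adj _ _ v) 0 0 by rewrite vH -scalemxAl mxE.
  by rewrite -[in RHS]cc !mxE.
have : z^*%C = z.
  by apply: (mulIf N0); rewrite -{1}Nr -rmorphM.
by case: z {vH zN} => a b /= [] h; have -> : b = 0 by lra.
Qed.

Lemma herm_sorted_eigvals n (H : 'M[C]_n) : herm_mx H -> exists s, is_sorted_eigvals H s.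
Proof.
move=> hH; have [r] := closed_field_poly_normal (char_poly H).
have /monicP -> := char_poly_monic H; rewrite scale1r => Hr.
exists (sort <=%R [seq complex.Re z | z <- r]); split.
- rewrite size_sort size_map; have := size_char_poly H; rewrite Hr size_prod_XsubC.
  by case.
- exact: sort_le_sorted.
- rewrite (perm_big [seq complex.Re z | z <- r]) ?perm_sort // big_map Hr.
  apply: eq_big_seq => z zr; rewrite -(herm_eigenvalue_real hH) //.
  by rewrite Hr root_prod_XsubC.
Qed.

Lemma prod_complex_pXs (s : seq R) :
  \prod_(x <- s) ('X - (x%:C)%C%:P) = map_poly (real_complex R) (pXs s).
Proof.
rewrite /pXs rmorph_prod; apply: eq_bigr => x _.
by rewrite rmorphB /= map_polyX map_polyC.
Qed.

(** Taking real parts is not multiplicative, but it undoes the embedding of the reals; this brings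
    the characteristic polynomial back to a real one. *)
Lemma map_Re_complex (p : {poly R}) : map_poly (@complex.Re R) (map_poly (real_complex R) p) = p.
Proof. by apply/polyP => i; rewrite coef_map_id0 // coef_map. Qed.

Lemma sorted_eigvals_unique n (H : 'M[C]_n) s : is_sorted_eigvals H s -> eigvals H = s.
Proof.
move=> Hs; rewrite /eigvals; case: pselect => [P|]; last by case; exists s.
case: (cid P) => s' /= [_ so' e']; have [_ so e] := Hs.
apply: le_sorted_eq => //; apply: prod_XsubC_eq.
rewrite -[LHS](map_Re_complex (pXs s')) -[RHS](map_Re_complex (pXs s)).
by rewrite -!prod_complex_pXs -e e'.
Qed.

Lemma eigvals_sorted n (H : 'M[C]_n) : size (eigvals H) = n /\ sorted <=%R (eigvals H).
Proof.
rewrite /eigvals; case: pselect => [P|_]; first by case: (cid P) => s' /= [].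
by rewrite size_nseq; split=> //; case: n {H} => //= n; elim: n => //= n ->; rewrite lexx.
Qed.

Lemma lam_le n (H : 'M[C]_n) i j : (i <= j < n)%N -> lam H i <= lam H j.
Proof.
move=> /andP[ij jn]; have [sz so] := eigvals_sorted H.
by apply: (sorted_leq_nth le_trans lexx) => //; rewrite inE sz // (leq_ltn_trans ij).
Qed.

(** Order to the right of 0 only: analytic branches that meet at 0 may exchange their order for t <
    0, and a two-sided relation would not be total. *)
Definition germ_le (f g : R -> R) : bool := `[< \forall t \near (0 : R), 0 <= t -> f t <= g t >].

(** The sign of the leading coefficient of g - f decides for all small t >= 0. *)
Lemma germ_le_total (f g : R -> R) : an f -> an g -> germ_le f g || germ_le g f.
Proof.
move=> af ag; have [fg|[m [h [ah h0 fg]]]] := an_lead (closed_funB (an_closed R) ag af).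
  apply/orP; left; apply/asboolP; apply: filterS fg => t /eqP; rewrite subr_eq0 => /eqP -> _.
  exact: lexx.
have hn := an_nonzero ah h0.
move: (h0); rewrite neq_lt => /orP[hs|hs]; apply/orP; [right|left]; apply/asboolP; near=> t => t0.
- rewrite -subr_le0; have -> : g t - f t = t ^+ m * h t by near: t.
  rewrite mulr_ge0_le0 ?exprn_ge0 //.
  have : `|h t - h 0| < `|h 0| / 2 by near: t.
  by rewrite (ltr0_norm hs) ltr_norml => /andP[]; lra.
- rewrite -subr_ge0; have -> : g t - f t = t ^+ m * h t by near: t.
  rewrite mulr_ge0 ?exprn_ge0 //.
  have : `|h t - h 0| < `|h 0| / 2 by near: t.
  by rewrite (gtr0_norm hs) ltr_norml => /andP[]; lra.
Unshelve. all: by end_near. Qed.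

Lemma germ_sorted_near (fs : seq (R -> R)) : sorted germ_le fs ->
  \forall t \near (0 : R), 0 <= t -> sorted <=%R [seq f t | f <- fs].
Proof.
have near_true : \forall t \near (0 : R), 0 <= t -> true by near=> t.
suff key f s : path germ_le f s ->
    \forall t \near (0 : R), 0 <= t -> path <=%R (f t) [seq h t | h <- s].
  by case: fs => // f s; exact: key.
elim: s f => [|g s ih] f //.
move=> /andP[/asboolP fg /ih gs]; near=> t => t0.
by apply/andP; split; move: t0; near: t.
Unshelve. all: by end_near. Qed.

Lemma sort_germs (fs : seq (R -> R)) : (forall f, f \in fs -> an f) ->
  exists gs, perm_eq gs fs /\
    \forall t \near (0 : R), 0 <= t -> sorted <=%R [seq f t | f <- gs].
Proof.
move=> afs; exists (sort germ_le fs); split; first by rewrite perm_sort.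
(* Totality holds among analytic germs, hence sortedness is taken relative to that predicate. *)
apply: germ_sorted_near; apply: (@sort_sorted_in _ [pred f | `[< an f >]] germ_le).
  by move=> f g /asboolP af /asboolP ag; exact: germ_le_total.
by apply/allP => f /afs h; exact/asboolP.
Qed.

Theorem eigval_germs n (eps : R) (H : R -> 'M[C]_n) : 0 < eps ->
  (forall t : R, `|t| < eps -> herm_mx (H t)) -> real_analytic_mx eps H ->
  exists fs : seq (R -> R), [/\ size fs = n, forall f, f \in fs -> an f &
    \forall t \near (0 : R), 0 <= t -> eigvals (H t) = [seq f t | f <- fs]].
Proof.
move=> e0 hH aH.
pose P t := map_poly (@complex.Re R) (char_poly (H t)).
have PE t s : is_sorted_eigvals (H t) s -> P t = pXs s.
  by move=> [_ _ e]; rewrite /P e prod_complex_pXs map_Re_complex.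
have ex : \forall t \near (0 : R), exists s, is_sorted_eigvals (H t) s.
  by near=> t; apply/herm_sorted_eigvals/hH; near: t; exact: near0_lt.
have [|||fs [sfs afs Pfs]] := @rellich_poly R n P.
- move=> i; have [j k|] := goodp_char_poly (H := H) _ i.
    have [h1 h2] := aH j k.
    by split; [exact: real_analytic_on_an e0 h1|exact: real_analytic_on_an e0 h2].
  by move=> h _; under eq_fun do rewrite coef_map_id0 //.
- near=> t; have [s hs] : exists s, is_sorted_eigvals (H t) s by near: t.
  by rewrite (PE _ _ hs) monic_pXs size_pXs; case: hs => ->.
- near=> t => _; have [s hs] : exists s, is_sorted_eigvals (H t) s by near: t.
  by exists s; exact: PE.
have [gs [pgs sgs]] := sort_germs afs.
exists gs; split; first by rewrite (perm_size pgs).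
  by move=> f; rewrite (perm_mem pgs); exact: afs.
near=> t => t0; have [s hs] : exists s, is_sorted_eigvals (H t) s by near: t.
rewrite (sorted_eigvals_unique hs); have [_ so _] := hs.
apply: le_sorted_eq => //; first by move: t0; near: t.
apply: prod_XsubC_eq; rewrite -[LHS]/(pXs s) -(PE _ _ hs).
have -> : P t = pXf fs t by near: t.
by rewrite /pXf big_map; apply/esym/perm_big.
Unshelve. all: by end_near. Qed.

End Eigenvalues.

(** * Orders of vanishing *)

Section Orders.
Variable R : realType.

Definition agree (g F : R -> R) := \forall t \near (0 : R), 0 <= t -> g t = F t.
(** One-sided germs: on t >= 0 the function agrees with one that is analytic on both sides. Sorted
    eigenvalues and their dispersion are in general analytic only in this sense. *)
Definition germ0 (g : R -> R) := exists2 F, an F & agree g F.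

Lemma germ0D (f g : R -> R) : germ0 f -> germ0 g -> germ0 (fun t => f t + g t).
Proof.
move=> [F aF fF] [G aG gG]; exists (fun t => F t + G t).
  by have [_ add _] := an_closed R; exact: add.
near=> t => t0; have -> : f t = F t by move: t0; near: t.
by congr (_ + _); move: t0; near: t.
Unshelve. all: by end_near. Qed.

Lemma germ0M (f g : R -> R) : germ0 f -> germ0 g -> germ0 (fun t => f t * g t).
Proof.
move=> [F aF fF] [G aG gG]; exists (fun t => F t * G t).
  by have [_ _ mul] := an_closed R; exact: mul.
near=> t => t0; have -> : f t = F t by move: t0; near: t.
by congr (_ * _); move: t0; near: t.
Unshelve. all: by end_near. Qed.

Lemma germ0_const (c : R) : germ0 (fun=> c).
Proof.
exists (fun=> c); first by have [cst _ _] := an_closed R; exact: cst.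
by near=> t.
Unshelve. all: by end_near. Qed.

Lemma germ0_closed : closed_fun germ0.
Proof. by split; [exact: germ0_const|exact: germ0D|exact: germ0M]. Qed.

(** Stated for all e near 0, being vacuous for e <= 0, so that a common interval for finitely many
    functions comes from intersecting neighbourhoods. *)
Lemma germ0_has_ps (g : R -> R) : germ0 g -> \forall e \near (0 : R), has_ps_on g e.
Proof.
move=> [F [a aF] gF].
have : \forall t \near (0 : R), ps_conv a 0 t (F t) /\ (0 <= t -> g t = F t).
  by near=> t; split; near: t.
move=> /near0_ex[r r0 h]; near=> e; exists a => t /andP[t0 te].
have [|h1 ->//] := h t; rewrite (ger0_norm t0) (lt_le_trans te) //.
by apply: (le_trans (ler_norm _)); apply: ltW; near: e; exact: near0_lt.
Unshelve. all: by end_near. Qed.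

(** The chosen expansion is known to converge only to the right of 0. Convergence at the point e / 2
    already bounds the coefficients geometrically, so the series converges on both sides and defines
    F. *)
Lemma coefs0_psg (g : R -> R) : germ0 g -> exists2 F, psg (coefs0 g) F & agree g F.
Proof.
move=> gg; rewrite /coefs0; case: pselect => [P|]; last first.
  move=> n; exfalso; apply: n.
  have /near0_pos[e e0 [[a ha] _]] := germ0_has_ps gg.
  by exists a, e.
case: (cid P) => a /= [e e0 ha].
have e2 : 0 <= e / 2 < e by rewrite divr_ge0 ?(ltW e0) //= ltr_pdivrMr // ltr_pMr // ltr1n.
have [|K [r [K0 r0 aK]]] := ps_conv_geometric_bound _ (ha _ e2).
  by rewrite gt_eqF // divr_gt0.
have [F [aF _]] := geometric_bound_psg aK (ltW r0); exists F => //.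
near=> t => t0; apply: (@ps_conv_unique _ a t); last by near: t.
apply: ha; rewrite t0 /=; apply: (le_lt_trans (ler_norm _)).
by near: t; exact: near0_lt.
Unshelve. all: by end_near. Qed.

Definition bigO0 (g : R -> R) m := exists C : R, \forall t \near (0 : R), 0 <= t -> `|g t| <= C * t ^+ m.

Lemma ordz_ge (g : R -> R) m : germ0 g -> (m%:R%:E <= ordz g)%E <-> bigO0 g m.
Proof.
move=> /coefs0_psg[F aF gF]; rewrite /ordz.
have [a0|[M [h [aM1 aM ah h0 Fh]]]] := psg_lead aF.
  case: pselect => [P|_]; first by exfalso; case: P => k; rewrite a0 eqxx.
  rewrite leey; split=> // _; exists 0; near=> t => t0.
  have -> : g t = F t by move: t0; near: t.
  have -> : F t = 0; last by rewrite normr0 mul0r.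
  near: t; apply: psg_unique_near aF _; apply: eq_psg (psg0 R) => // k; by rewrite a0.
case: pselect => [P|]; last by case; exists M.
have -> : ex_minn P = M.
  case: ex_minnP => k ak kmin; apply/eqP; rewrite eqn_leq kmin //=.
  by rewrite leqNgt; apply: contra ak => /aM1 ->.
rewrite -h0 in aM.
rewrite lee_fin ler_nat; split=> [mM|[C gC]].
  exists (2 * `|h 0|); near=> t => t0.
  have -> : g t = F t by move: t0; near: t.
  have -> : F t = t ^+ M * h t by near: t.
  have t1 : `|t| < 1 by near: t; exact: near0_lt.
  rewrite (ger0_norm t0) in t1.
  rewrite normrM normrX (ger0_norm t0) mulrC ler_pM ?exprn_ge0 //.
    have : `|h t - h 0| < `|h 0| / 2 by near: t; exact: an_nonzero.
    by have := ler_normD (h t - h 0) (h 0); rewrite subrK; have := normr_ge0 (h 0); lra.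
  by rewrite ler_wiXn2l // ltW.
apply: (@order_le_of_bound R h m M C) => //; near=> t => t0.
have <- : F t = t ^+ M * h t by near: t.
have <- : g t = F t by move: (ltW t0); near: t.
by move: (ltW t0); near: t.
Unshelve. all: by end_near. Qed.

(** Orders are compared by testing natural thresholds m <= x, which determine x only among these
    values of [\bar R]. *)
Definition nat_or_oo (x : \bar R) := x = +oo%E \/ exists M : nat, x = M%:R%:E.

Lemma ordz_nat_or_oo (g : R -> R) : nat_or_oo (ordz g).
Proof.
by rewrite /ordz; case: pselect => [P|_]; [right; eexists|left].
Qed.

Lemma bigmin_nat_or_oo n (F : 'I_n -> \bar R) : (forall i, nat_or_oo (F i)) ->
  nat_or_oo (\big[Order.min/+oo%E]_(i < n) F i).
Proof.
move=> hF; apply: big_ind => //; first by left.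
by move=> x y hx hy; rewrite minEle; case: ifP.
Qed.

Lemma nat_or_oo_eq (x y : \bar R) : nat_or_oo x -> nat_or_oo y ->
  (forall m : nat, (m%:R%:E <= x)%E <-> (m%:R%:E <= y)%E) -> x = y.
Proof.
have le (u v : \bar R) : nat_or_oo u -> nat_or_oo v ->
    (forall m : nat, (m%:R%:E <= u)%E -> (m%:R%:E <= v)%E) -> (u <= v)%E.
  move=> [->|[M ->]] hv h; last exact: h.
  case: hv h => [->//|[N ->]] /(_ N.+1); rewrite leey => /(_ isT).
  by rewrite lee_fin ler_nat ltnn.
by move=> hx hy h; apply/eqP; rewrite eq_le !le // => m; rewrite h.
Qed.

Lemma bigO0_le (c : R) (f g : R -> R) m : (forall t, `|g t| <= c * `|f t|) -> 0 <= c ->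
  bigO0 f m -> bigO0 g m.
Proof.
move=> gf c0 [C fC]; exists (c * C); apply: filterS fC => t h t0.
by apply: (le_trans (gf t)); rewrite -mulrA ler_wpM2l // h.
Qed.

Lemma bigO0_sum n (f : 'I_n -> R -> R) m : (forall i, bigO0 (f i) m) ->
  bigO0 (fun t => \sum_(i < n) f i t) m.
Proof.
move=> /choice[C fC]; exists (\sum_(i < n) C i).
have : \forall t \near (0 : R), forall i, 0 <= t -> `|f i t| <= C i * t ^+ m.
  exact: (@filter_forall _ 'I_n (fun i t => 0 <= t -> `|f i t| <= C i * t ^+ m) (nbhs (0 : R))).
apply: filterS => t h t0; apply: (le_trans (ler_norm_sum _ _ _)).
by rewrite mulr_suml; apply: ler_sum => i _; exact: h.
Qed.

Lemma bigO0D (f g : R -> R) m : bigO0 f m -> bigO0 g m -> bigO0 (fun t => f t - g t) m.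
Proof.
move=> [C fC] [D gD]; exists (C + D); near=> t => t0.
apply: (le_trans (ler_normB _ _)); rewrite mulrDl lerD //; move: t0; near: t => //.
Unshelve. all: by end_near. Qed.

(* The polynomial X^2 - v is real-rooted, so its roots are germs. *)
Lemma sqrt_germ0 (v : R -> R) : an v -> (forall t, 0 <= v t) -> germ0 (fun t => Num.sqrt (v t)).
Proof.
move=> av v0; have acl := an_closed R; have [cst add mul] := acl.
have gcl := goodp_closed acl; have [gcst gadd gmul] := gcl.
pose P t : {poly R} := 'X^2 - (v t)%:P.
have Pr t : P t = pXs [:: Num.sqrt (v t); - Num.sqrt (v t)].
  rewrite /P /pXs !big_cons big_nil mulr1 polyCN opprK -{1}(sqr_sqrtr (v0 t)) polyC_exp.
  by ring.
have [|||fs [sfs afs Pfs]] := @rellich_poly R 2 P.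
- by apply: (closed_funB gcl); [exact: gcst|exact: goodpC].
- by near=> t; rewrite Pr monic_pXs size_pXs.
- by near=> t => _; exists [:: Num.sqrt (v t); - Num.sqrt (v t)].
case: fs sfs afs Pfs => [|f [|g [|//]]] // _ afs Pfs.
have af : an f by apply: afs; rewrite mem_head.
have vf : \forall t \near (0 : R), Num.sqrt (v t) = `|f t|.
  apply: filterS Pfs => t Pt; have : root (P t) (f t).
    by rewrite Pt pXf_map root_prod_XsubC mem_head.
  rewrite /P /root !hornerE subr_eq0 => /eqP <-.
  by rewrite sqrtr_sqr.
(* The branch f does not change sign to the right of 0, so |f| is f or - f there. *)
have [cz|cz] := orP (germ_le_total (cst 0) af); move/asboolP: cz => cz.
  exists f => //; near=> t => t0; have -> : Num.sqrt (v t) = `|f t| by near: t.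
  by rewrite ger0_norm //; move: t0; near: t.
exists (fun t => - f t); first exact: closed_funN.
near=> t => t0; have -> : Num.sqrt (v t) = `|f t| by near: t.
by rewrite ler0_norm //; move: t0; near: t.
Unshelve. all: by end_near. Qed.

End Orders.

(** * Pointwise inequalities between dispersion, deviations and spread *)

Section Dispersion.
Variables (R : realType) (n k : nat) (H : 'M[R[i]]_n).
Hypotheses (k0 : (0 < k)%N) (kn : (k <= n)%N).

Let kR0 : 0 < k%:R :> R. Proof. by rewrite ltr0n. Qed.

Lemma Dk_ge0 : 0 <= Dk k H. Proof. exact: sqrtr_ge0. Qed.

Lemma sqr_Dk : Dk k H ^+ 2 = k%:R^-1 * \sum_(j < k) (lam H j - lbar k H) ^+ 2.
Proof.
rewrite sqr_sqrtr // mulr_ge0 ?invr_ge0 ?(ltW kR0) // sumr_ge0 // => j _.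
exact: sqr_ge0.
Qed.

(** The sum of squares k D_k^2 contains the square of the given deviation; this yields the constant
    sqrt k, which is at most k. *)
Lemma deviation_le_Dk i : (i < k)%N -> `|lam H i - lbar k H| <= k%:R * `|Dk k H|.
Proof.
move=> ik; rewrite (ger0_norm Dk_ge0) -(ler_pXn2r (ltn0Sn 1)) ?nnegrE ?mulr_ge0 ?Dk_ge0 ?(ltW kR0) //.
rewrite real_normK ?num_real // exprMn sqr_Dk expr2 -mulrA (mulrA _ k%:R^-1) divff ?gt_eqF // mul1r.
set S := \sum_(j < k) _.
have h : (lam H i - lbar k H) ^+ 2 <= S.
  by rewrite /S (bigD1 (Ordinal ik)) //= lerDl sumr_ge0 // => j _; exact: sqr_ge0.
apply: (le_trans h); rewrite ler_peMl ?ler1n //.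
exact: le_trans (sqr_ge0 _) h.
Qed.

(** The mean lies between the extreme eigenvalues, so every deviation, and with it the quadratic
    mean of the deviations, is at most their distance. *)
Lemma Dk_le_spread : `|Dk k H| <= 1 * `|lam H 0 - lam H k.-1|.
Proof.
have k1 : (k.-1 < k)%N by rewrite ltn_predL.
have lo j : (j < k)%N -> lam H 0 <= lam H j.
  by move=> jk; apply: lam_le; rewrite (leq_trans jk).
have hi j : (j < k)%N -> lam H j <= lam H k.-1.
  by move=> jk; apply: lam_le; rewrite (leq_trans k1) // andbT -ltnS prednK.
have sc (c : R) : \sum_(j < k) c = c *+ k by rewrite sumr_const card_ord.
have lb0 : lam H 0 <= lbar k H.
  rewrite /lbar mulrC ler_pdivlMr // mulr_natr -sc.
  by apply: ler_sum => j _; exact: lo.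
have lb1 : lbar k H <= lam H k.-1.
  rewrite /lbar mulrC ler_pdivrMr // mulr_natr -sc.
  by apply: ler_sum => j _; exact: hi.
rewrite mul1r (ger0_norm Dk_ge0) -(ler_pXn2r (ltn0Sn 1)) ?nnegrE ?Dk_ge0 //.
rewrite real_normK ?num_real // sqr_Dk mulrC ler_pdivrMr // mulr_natr.
rewrite -sc; apply: ler_sum => j _.
have h1 := lo j (ltn_ord j); have h2 := hi j (ltn_ord j).
have hd : `|lam H j - lbar k H| <= lam H k.-1 - lam H 0.
  by rewrite ler_norml; apply/andP; split; lra.
rewrite -[leRHS]sqrrN opprB -[leLHS]real_normK ?num_real // lerXn2r ?nnegrE //.
exact: le_trans (normr_ge0 _) hd.
Qed.

End Dispersion.

Unset Implicit Arguments.
Set Strict Implicit.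
Set Printing Implicit Defensive.

(* Indices are 0-based: lam _ i is lambda_{i+1}; i < j < k stands for 1 <= i < j <= k. *)
Theorem mainTheorem6 (R : realType) (n k : nat) (eps0 : R)
    (H : R -> 'M[R[i]]_n) :
  (2 <= k)%N -> (k <= n.-1)%N -> 0 < eps0 ->
  (forall t : R, `|t| < eps0 -> herm_mx (H t)) ->
  real_analytic_mx eps0 H ->
  in_Sigma k (H 0) ->
  let s_k := fun t : R => Dk k (H t) in
  let s := fun (i j : nat) (t : R) => lam (H t) i - lam (H t) j in
  let sbar := fun (i : nat) (t : R) => lam (H t) i - lbar k (H t) in
  exists2 eps : R, 0 < eps /\ eps <= eps0 &
    [/\ has_ps_on s_k eps,
        (forall i j : nat, (i < j < k)%N -> has_ps_on (s i j) eps) &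
        (forall i : nat, (i < k)%N -> has_ps_on (sbar i) eps)] /\
    [/\ ordz s_k =
          \big[Order.min/+oo%E]_(j < k) \big[Order.min/+oo%E]_(i < j)
             ordz (s (nat_of_ord i) (nat_of_ord j)),
        ordz s_k =
          \big[Order.min/+oo%E]_(i < k.-1) ordz (s (nat_of_ord i) i.+1),
        ordz s_k = ordz (s 0%N k.-1) &
        ordz s_k = \big[Order.min/+oo%E]_(i < k) ordz (sbar (nat_of_ord i))].
Proof.
move=> k2 kn1 e0 hH aH _ s_k s sbar.
have kpos : (0 < k)%N by exact: leq_trans k2.
have kn : (k <= n)%N by exact: leq_trans kn1 (leq_pred _).
have k1 : (k.-1 < k)%N by rewrite ltn_predL.
have gcl := germ0_closed R; have acl := an_closed R.
have [fs [sfs afs eig]] := eigval_germs e0 hH aH.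
pose F j := nth (fun=> 0) fs j.
have aF j : (j < k)%N -> an (F j).
  by move=> jk; apply: afs; rewrite mem_nth // sfs (leq_trans jk).
have lamF : \forall t \near (0 : R), 0 <= t -> forall j, (j < k)%N -> lam (H t) j = F j t.
  apply: filterS eig => t h t0 j jk.
  by rewrite /lam (h t0) (nth_map (fun=> 0)) // sfs (leq_trans jk).
pose Fbar t := k%:R^-1 * \sum_(j < k) F j t.
have aFbar : an Fbar.
  have [cst _ mul] := acl; apply: mul; first exact: cst.
  by apply: (closed_fun_sum acl) => j _; exact: aF.
have lbarF : \forall t \near (0 : R), 0 <= t -> lbar k (H t) = Fbar t.
  apply: filterS lamF => t h t0; congr (_ * _); apply: eq_bigr => j _.
  exact: h.
have g_lam j : (j < k)%N -> germ0 (fun t => lam (H t) j).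
  by move=> jk; exists (F j); [exact: aF|apply: filterS lamF => t h t0; exact: h].
have g_lbar : germ0 (fun t => lbar k (H t)) by exists Fbar.
have g_s i j : (i < k)%N -> (j < k)%N -> germ0 (s i j).
  by move=> ik jk; apply: (closed_funB gcl); exact: g_lam.
have g_sbar i : (i < k)%N -> germ0 (sbar i).
  by move=> ik; apply: (closed_funB gcl) => //; exact: g_lam.
(* Built from the analytic branches, v is analytic on both sides of 0 and nonnegative for every t;
   it equals D_k^2 for small t >= 0. *)
pose v t := k%:R^-1 * \sum_(j < k) (F j t - Fbar t) ^+ 2.
have g_sk : germ0 s_k.
  have [||G aG vG] := @sqrt_germ0 R v.
  - have [cst _ mul] := acl; apply: mul; first exact: cst.
    apply: (closed_fun_sum acl) => j _; apply: (closed_funX acl).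
    by apply: (closed_funB acl) => //; exact: aF.
  - by move=> t; rewrite mulr_ge0 ?invr_ge0 // sumr_ge0 // => j _; exact: sqr_ge0.
  exists G => //; near=> t => t0.
  have <- : Num.sqrt (v t) = G t by move: t0; near: t.
  have lb : lbar k (H t) = Fbar t by move: t0; near: t.
  have lF : forall j, (j < k)%N -> lam (H t) j = F j t by move: t0; near: t.
  by rewrite /s_k /Dk lb; congr (Num.sqrt (_ * _)); apply: eq_bigr => j _; rewrite lF.
have ps : \forall e \near (0 : R), [/\ has_ps_on s_k e,
    forall ij : 'I_k * 'I_k, has_ps_on (s ij.1 ij.2) e,
    forall i : 'I_k, has_ps_on (sbar i) e & `|e| < eps0].
  have ps1 : \forall e \near (0 : R), forall ij : 'I_k * 'I_k, has_ps_on (s ij.1 ij.2) e.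
    apply: (@filter_forall _ ('I_k * 'I_k)%type (fun ij e => has_ps_on (s ij.1 ij.2) e) (nbhs (0 : R))) => -[i j].
    by apply: germ0_has_ps; exact: g_s.
  have ps2 : \forall e \near (0 : R), forall i : 'I_k, has_ps_on (sbar i) e.
    apply: (@filter_forall _ 'I_k (fun i e => has_ps_on (sbar i) e) (nbhs (0 : R))) => i.
    by apply: germ0_has_ps; exact: g_sbar.
  have ps3 := germ0_has_ps g_sk.
  by near=> e; split; near: e => //; exact: near0_lt.
have [e ep [[p1 p2 p3 p4] _]] := near0_pos ps.
exists e; first by rewrite ep -(gtr0_norm ep) ltW.
split; first split=> //.
- move=> i j /andP[ij jk]; exact: (p2 (Ordinal (ltn_trans ij jk), Ordinal jk)).
- by move=> i ik; exact: (p3 (Ordinal ik)).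
(* For each m the implications close a circle: D_k bounds the deviations, these bound all gaps, the
   consecutive gaps bound the gap between the extreme eigenvalues, and that gap bounds D_k. All the
   orders therefore pass the same thresholds. *)
have O1 m : bigO0 s_k m -> forall i, (i < k)%N -> bigO0 (sbar i) m.
  move=> h i ik; apply: (@bigO0_le _ k%:R s_k) => // t.
  exact: deviation_le_Dk.
have O2 m : (forall i, (i < k)%N -> bigO0 (sbar i) m) ->
    forall i j, (i < k)%N -> (j < k)%N -> bigO0 (s i j) m.
  move=> h i j ik jk; have := bigO0D (h i ik) (h j jk).
  apply: (@bigO0_le _ 1) => // t; rewrite mul1r /s /sbar le_eqVlt; apply/orP; left.
  by apply/eqP; congr (`|_|); ring.
(* The extreme gap is the telescoping sum of the consecutive gaps. *)
have O3 m : (forall i, (i < k.-1)%N -> bigO0 (s i i.+1) m) -> bigO0 (s 0%N k.-1) m.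
  move=> h; have := bigO0_sum (f := fun i : 'I_k.-1 => s i i.+1) (fun i => h i (ltn_ord i)).
  apply: (@bigO0_le _ 1) => // t; rewrite mul1r le_eqVlt; apply/orP; left; apply/eqP.
  congr (`|_|); rewrite /s; elim: (k.-1) => [|l ih]; first by rewrite big_ord0 subrr.
  by rewrite big_ord_recr /= -ih; ring.
have O4 m : bigO0 (s 0%N k.-1) m -> bigO0 s_k m.
  by apply: (@bigO0_le _ 1) => // t; exact: Dk_le_spread.
have nOs := ordz_nat_or_oo.
split; (apply: nat_or_oo_eq; [exact: nOs| |move=> m; rewrite (ordz_ge _ g_sk)]).
- by apply: bigmin_nat_or_oo => j; exact: bigmin_nat_or_oo.
- split=> [h|/bigmin_geP[_ h]].
    apply/bigmin_geP; split; rewrite ?leey // => j _; apply/bigmin_geP; split; rewrite ?leey // => i _.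
    have ik := ltn_trans (ltn_ord i) (ltn_ord j).
    by apply/ordz_ge; [exact: g_s|apply: O2 => //; exact: O1].
  apply/O4/ordz_ge; first exact: g_s.
  (* Because 2 <= k, the pair (0, k - 1) is among the pairs i < j of the double minimum. *)
  have k10 : (0 < k.-1)%N by rewrite -subn1 subn_gt0.
  have /bigmin_geP[_ h2] := h (Ordinal k1) isT.
  exact: (h2 (Ordinal k10) isT).
- exact: bigmin_nat_or_oo.
- have lt1 (i : 'I_k.-1) : (i < k)%N /\ (i.+1 < k)%N by have := ltn_ord i; lia.
  split=> [h|/bigmin_geP[_ h]].
    apply/bigmin_geP; split; rewrite ?leey // => i _; have [h1 h2] := lt1 i.
    by apply/ordz_ge; [exact: g_s|apply: O2 => //; exact: O1].
  apply/O4/O3 => i ik; have [h1 h2] := lt1 (Ordinal ik).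
  by apply/ordz_ge; [exact: g_s|exact: (h (Ordinal ik) isT)].
- exact: nOs.
- split=> h; first by apply/ordz_ge; [exact: g_s|apply: O2 => //; exact: O1].
  by apply/O4/ordz_ge => //; exact: g_s.
- exact: bigmin_nat_or_oo.
- split=> [h|/bigmin_geP[_ h]].
    apply/bigmin_geP; split; rewrite ?leey // => i _.
    by apply/ordz_ge; [exact: g_sbar|exact: O1].
  apply/O4/O2 => // i ik; apply/ordz_ge; first exact: g_sbar.
  exact: (h (Ordinal ik) isT).
Unshelve. all: by end_near. Qed.
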